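(* Let $\{(x^i,y_i)\}_{i=1}^n\subset\mathbb{R}_+^d\times[K]$, $p_w,p_u\in(1,\infty)$, $\rho_w,\rho_u>0$, $n_1\in\mathbb{N}$, $\epsilon>0$ and $\alpha\in\mathbb{R}^{n_1}$ with $\alpha_l\ge 1$ for all $l\in[n_1]$. Define $$\rho_x=\max_{i\in[n]}\|x^i\|_1,\qquad \xi_1=\rho_w\sum_{l=1}^{n_1}(\rho_u\rho_x)^{\alpha_l},\qquad \xi_2=\rho_w\sum_{l=1}^{n_1}\alpha_l(\rho_u\rho_x)^{\alpha_l},$$ and let $A\in\mathbb{R}^{(K+1)\times(K+1)}_{++}$ be given by $$A_{l,m}=4(p_w'-1)\xi_1,\quad A_{l,K+1}=2(p_w'-1)(2\xi_2+\|\alpha\|_\infty),$$ $$A_{K+1,m}=2(p_u'-1)(2\xi_1+1),\quad A_{K+1,K+1}=2(p_u'-1)(2\xi_2+\|\alpha\|_\infty-1),$$ for all $l,m\in[K]$. If the spectral radius satisfies $\rho(A)<1$, then the problem $\max_{(w,u)\in S_+}\Phi(w,u)$ has a unique global maximizer $(w^*,u^* )$, and it lies in $S_{++}$. Moreover, for every $(w^0,u^0)\in S_{++}$, the sequence defined by $(w^{k+1},u^{k+1})=G^{\Phi}(w^k,u^k)$ satisfies $\lim_{k\to\infty}(w^k,u^k)=(w^*,u^* )$, and there exists $R>0$ such that $\|(w^k,u^k)-(w^*,u^* )\|_\infty\le R\,\rho(A)^k$ for all $k\in\mathbb{N}$.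
   Context: Notation: $[m]=\{1,\dots,m\}$, $\mathbb{R}_+=[0,\infty)$, $\mathbb{R}_{++}=(0,\infty)$. For $p\in(1,\infty)$, $p'=p/(p-1)$ and $\psi_p(z)=\operatorname{sign}(z)|z|^{p-1}$, applied componentwise to vectors/matrices. For a matrix, $\|\cdot\|_p$ denotes the entrywise $\ell_p$ norm (the matrix viewed as a vector); $\|\cdot\|_\infty$ of a pair $(w,u)$ is the maximum absolute entry. $\rho(A)$ is the spectral radius. Setting (one hidden layer network): data $(x^i,y_i)\in\mathbb{R}^d_+\times[K]$, $i\in[n]$. Parameters $w\in\mathbb{R}^{K\times n_1}_+$ with rows $w_1,\dots,w_K\in\mathbb{R}^{n_1}_+$ and $u\in\mathbb{R}^{n_1\times d}_+$. For $\alpha\in\mathbb{R}^{n_1}$ with all $\alpha_l\ge1$, the network is $f_r(w,u)(x)=\sum_{l=1}^{n_1}w_{r,l}\big(\sum_{m=1}^d u_{lm}x_m\big)^{\alpha_l}$, $r\in[K]$. Loss: $L(y,f(x))=-f_y(x)+\log\sum_{j=1}^K e^{f_j(x)}$. Objective, for $\epsilon>0$: $$\Phi(w,u)=\frac1n\sum_{i=1}^n\Big[-L\big(y_i,f(w,u)(x^i)\big)+\sum_{r=1}^K f_r(w,u)(x^i)\Big]+\epsilon\Big(\sum_{r=1}^K\sum_{l=1}^{n_1}w_{r,l}+\sum_{l=1}^{n_1}\sum_{m=1}^d u_{lm}\Big).$$ Feasible set: $S_+=\{(w,u)\in\mathbb{R}^{K\times n_1}_+\times\mathbb{R}^{n_1\times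 d}_+ : \|u\|_{p_u}=\rho_u,\ \|w_i\|_{p_w}=\rho_w\ \forall i\in[K]\}$, and $S_{++}$ is the same set with $\mathbb{R}_+$ replaced by $\mathbb{R}_{++}$ (all entries strictly positive). The map $G^\Phi$ is $$G^{\Phi}(w,u)=\Big(\tfrac{\rho_w\psi_{p_w'}(\nabla_{w_1}\Phi(w,u))}{\|\psi_{p_w'}(\nabla_{w_1}\Phi(w,u))\|_{p_w}},\dots,\tfrac{\rho_w\psi_{p_w'}(\nabla_{w_K}\Phi(w,u))}{\|\psi_{p_w'}(\nabla_{w_K}\Phi(w,u))\|_{p_w}},\tfrac{\rho_u\psi_{p_u'}(\nabla_u\Phi(w,u))}{\|\psi_{p_u'}(\nabla_u\Phi(w,u))\|_{p_u}}\Big),$$ where $\nabla_{w_i}\Phi$, $\nabla_u\Phi$ are partial gradients. *)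

(* Defs.v *)
From Stdlib Require Import Reals Lra Lia Arith ClassicalEpsilon.
Open Scope R_scope.

(* Conventions: all index sets [m] = {1..m} are rendered 0-based as {0..m-1}
   (indices i < m of type nat).  Vectors / matrices are functions on nat
   whose values outside the index range are irrelevant. *)

Fixpoint rsum (n : nat) (f : nat -> R) : R :=
  match n with O => 0 | S k => rsum k f + f k end.

(* finite max of nonnegative quantities: max_{i<n} f i (0 if n = 0) *)
Fixpoint rmax (n : nat) (f : nat -> R) : R :=
  match n with O => 0 | S k => Rmax (rmax k f) (f k) end.

(* real power z^a for z >= 0 (and a > 0): z^a = exp(a ln z) if z > 0, 0 if z = 0 *)
Definition rpow (z a : R) : R := if Rlt_dec 0 z then Rpower z a else 0.

Definition conj_exp (p : R) : R := p / (p - 1).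

Definition psi (p z : R) : R :=
  if Rlt_dec 0 z then rpow z (p - 1)
  else if Rlt_dec z 0 then - rpow (- z) (p - 1) else 0.

Definition pnorm (p : R) (n : nat) (v : nat -> R) : R :=
  rpow (rsum n (fun i => rpow (Rabs (v i)) p)) (/ p).

Definition pnorm_mx (p : R) (n m : nat) (M : nat -> nat -> R) : R :=
  rpow (rsum n (fun i => rsum m (fun j => rpow (Rabs (M i j)) p))) (/ p).

Definition norm1 (n : nat) (v : nat -> R) : R := rsum n (fun i => Rabs (v i)).

Definition net (d n1 : nat) (alpha : nat -> R)
  (w u : nat -> nat -> R) (x : nat -> R) (r : nat) : R :=
  rsum n1 (fun l => w r l * rpow (rsum d (fun m => u l m * x m)) (alpha l)).

Definition loss (K : nat) (y : nat) (f : nat -> R) : R :=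
  - f y + ln (rsum K (fun j => exp (f j))).

Definition Phi (n d K n1 : nat) (alpha : nat -> R)
  (x : nat -> nat -> R) (y : nat -> nat) (eps : R)
  (w u : nat -> nat -> R) : R :=
  / INR n * rsum n (fun i =>
       - loss K (y i) (net d n1 alpha w u (x i))
       + rsum K (fun r => net d n1 alpha w u (x i) r))
  + eps * (rsum K (fun r => rsum n1 (fun l => w r l))
           + rsum n1 (fun l => rsum d (fun m => u l m))).

(* the derivative of f at x (the unique l with derivable_pt_lim f x l,
   an arbitrary value if f is not differentiable at x) *)
Definition deriv_at (f : R -> R) (x : R) : R :=
  epsilon (inhabits 0) (fun l => derivable_pt_lim f x l).

Definition upd (M : nat -> nat -> R) (i j : nat) (t : R) : nat -> nat -> R :=
  fun i' j' => if andb (Nat.eqb i' i) (Nat.eqb j' j) then t else M i' j'.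

Definition grad_w (F : (nat -> nat -> R) -> (nat -> nat -> R) -> R)
  (w u : nat -> nat -> R) (r l : nat) : R :=
  deriv_at (fun t => F (upd w r l t) u) (w r l).

Definition grad_u (F : (nat -> nat -> R) -> (nat -> nat -> R) -> R)
  (w u : nat -> nat -> R) (l m : nat) : R :=
  deriv_at (fun t => F w (upd u l m t)) (u l m).

Definition GPhi (F : (nat -> nat -> R) -> (nat -> nat -> R) -> R)
  (n1 d : nat) (pw pu rw ru : R)
  (wu : (nat -> nat -> R) * (nat -> nat -> R)) :
  (nat -> nat -> R) * (nat -> nat -> R) :=
  let (w, u) := wu in
  ( fun r l => rw * psi (conj_exp pw) (grad_w F w u r l)
         / pnorm pw n1 (fun l' => psi (conj_exp pw) (grad_w F w u r l')),
    fun l m => ru * psi (conj_exp pu) (grad_u F w u l m)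
         / pnorm_mx pu n1 d (fun l' m' => psi (conj_exp pu) (grad_u F w u l' m')) ).

Definition in_Splus (K n1 d : nat) (pw pu rw ru : R) (w u : nat -> nat -> R) : Prop :=
  (forall r l, (r < K)%nat -> (l < n1)%nat -> 0 <= w r l) /\
  (forall l m, (l < n1)%nat -> (m < d)%nat -> 0 <= u l m) /\
  pnorm_mx pu n1 d u = ru /\
  (forall r, (r < K)%nat -> pnorm pw n1 (w r) = rw).

Definition in_Splusplus (K n1 d : nat) (pw pu rw ru : R) (w u : nat -> nat -> R) : Prop :=
  (forall r l, (r < K)%nat -> (l < n1)%nat -> 0 < w r l) /\
  (forall l m, (l < n1)%nat -> (m < d)%nat -> 0 < u l m) /\
  pnorm_mx pu n1 d u = ru /\
  (forall r, (r < K)%nat -> pnorm pw n1 (w r) = rw).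

Definition dist_inf (K n1 d : nat) (w u w' u' : nat -> nat -> R) : R :=
  Rmax (rmax K (fun r => rmax n1 (fun l => Rabs (w r l - w' r l))))
       (rmax n1 (fun l => rmax d (fun m => Rabs (u l m - u' l m)))).

(* complex numbers as pairs (re, im) *)
Definition cmod (z : R * R) : R := sqrt (fst z * fst z + snd z * snd z).

Definition is_eigenvalue (N : nat) (A : nat -> nat -> R) (lam : R * R) : Prop :=
  exists v : nat -> R * R,
    (exists i, (i < N)%nat /\ v i <> (0, 0)) /\
    forall i, (i < N)%nat ->
      rsum N (fun j => A i j * fst (v j)) = fst lam * fst (v i) - snd lam * snd (v i) /\
      rsum N (fun j => A i j * snd (v j)) = fst lam * snd (v i) + snd lam * fst (v i).

Definition is_spectral_radius (N : nat) (A : nat -> nat -> R) (rho : R) : Prop :=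
  (exists lam, is_eigenvalue N A lam /\ cmod lam = rho) /\
  (forall lam, is_eigenvalue N A lam -> cmod lam <= rho).

(* ---------- the matrix A of the theorem (0-based: index K is "K+1") ---------- *)

Definition rho_x (n d : nat) (x : nat -> nat -> R) : R :=
  rmax n (fun i => norm1 d (x i)).

Definition xi1 (n d n1 : nat) (alpha : nat -> R) (x : nat -> nat -> R) (rw ru : R) : R :=
  rw * rsum n1 (fun l => rpow (ru * rho_x n d x) (alpha l)).

Definition xi2 (n d n1 : nat) (alpha : nat -> R) (x : nat -> nat -> R) (rw ru : R) : R :=
  rw * rsum n1 (fun l => alpha l * rpow (ru * rho_x n d x) (alpha l)).

Definition alpha_inf (n1 : nat) (alpha : nat -> R) : R := rmax n1 (fun l => Rabs (alpha l)).

Definition Amat (n d K n1 : nat) (alpha : nat -> R) (x : nat -> nat -> R)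
  (pw pu rw ru : R) : nat -> nat -> R :=
  let a1 := xi1 n d n1 alpha x rw ru in
  let a2 := xi2 n d n1 alpha x rw ru in
  let ai := alpha_inf n1 alpha in
  fun l m =>
    if Nat.ltb l K then
      (if Nat.ltb m K then 4 * (conj_exp pw - 1) * a1
       else 2 * (conj_exp pw - 1) * (2 * a2 + ai))
    else
      (if Nat.ltb m K then 2 * (conj_exp pu - 1) * (2 * a1 + 1)
       else 2 * (conj_exp pu - 1) * (2 * a2 + ai - 1)).

(* Main.v *)
Require Import Defs.
From Stdlib Require Import Reals Lra Lia Arith Bool List.
From Stdlib Require Import Classical ClassicalEpsilon FunctionalExtensionality.
Open Scope R_scope.

(** Measure distances blockwise in logarithmic coordinates: [a_r] for the row
    [w_r] and [b] for [u].  Every entry of the gradient is a sum of products of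
    nonnegative quantities, so its logarithmic variation is bounded without
    second derivatives, factor by factor; the powers [p' - 1] and the
    normalisation (a factor [2]) then give [D(G z, G z') <= A D(z, z')]
    entrywise.  Since the rows of [A] are constant on the [w]-blocks, a left
    Perron vector of a [2 x 2] quotient of [A] turns this into a contraction of
    rate [rho(A)] for a weighted sum of the [a_r] and [b].

    A maximizer over [S_+] exists by compactness.  Moving [p]-th powers of mass
    between two coordinates stays on the sphere: since all partial derivatives
    are at least [eps], this excludes zero entries of a maximizer, and it shows
    that the gradient is proportional to the [(p - 1)]-th powers of the entries,
    which says that the maximizer is a fixed point of [G].  The contraction
    then yields uniqueness and convergence. *)

(** * Finite sums, powers and multiplicative closeness *)

(** The constants of [Amat] can be read off the estimates. A summand of [net] is at most
    [rw * (ru * rho_x)^alpha_l], and its logarithm moves by at most [a r + alpha_l * b]; hence an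
    output moves by at most [xi1 * a r + xi2 * b] in absolute terms. Exponentiation turns this
    absolute change into a logarithmic one, and the quotient in the softmax doubles it. The term
    [rsum K f] of the objective is what prevents cancellation: it turns [- softmax] into
    [1 - softmax], the share of the remaining exponentials. The obstacle is the boundary. Since
    [rpow] is cut off at 0, the objective need not be differentiable where a preactivation vanishes,
    and [deriv_at] may then return an arbitrary value. So derivatives are taken only along curves on
    which each preactivation is positive or constant, and growth at a zero entry is measured by
    differences. The fixed point comes from the maximization, so the contraction argument needs no
    completeness of the strictly positive feasible set. *)

Lemma rsum_ext (n : nat) (f g : nat -> R) :
  (forall i, (i < n)%nat -> f i = g i) -> rsum n f = rsum n g.
Proof.
  induction n as [|n IH]; intros H; simpl; [reflexivity|].
  rewrite IH by (intros; apply H; lia). now rewrite H by lia.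
Qed.

Lemma rsum_le (n : nat) (f g : nat -> R) :
  (forall i, (i < n)%nat -> f i <= g i) -> rsum n f <= rsum n g.
Proof.
  induction n as [|n IH]; intros H; simpl; [lra|].
  apply Rplus_le_compat; [apply IH; intros; apply H; lia | apply H; lia].
Qed.

Lemma rsum_plus (n : nat) (f g : nat -> R) :
  rsum n (fun i => f i + g i) = rsum n f + rsum n g.
Proof. induction n as [|n IH]; simpl; [|rewrite IH]; lra. Qed.

Lemma rsum_scal (n : nat) (c : R) (f : nat -> R) :
  rsum n (fun i => c * f i) = c * rsum n f.
Proof. induction n as [|n IH]; simpl; [|rewrite IH]; lra. Qed.

Lemma rsum_const (n : nat) (c : R) : rsum n (fun _ => c) = INR n * c.
Proof. induction n as [|n IH]; [simpl; lra|]. rewrite S_INR. simpl. rewrite IH. lra. Qed.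

Lemma rsum_zero (n : nat) (f : nat -> R) :
  (forall i, (i < n)%nat -> f i = 0) -> rsum n f = 0.
Proof. intros H. rewrite (rsum_ext n f (fun _ => 0)) by exact H. rewrite rsum_const. lra. Qed.

Lemma rsum_nonneg (n : nat) (f : nat -> R) :
  (forall i, (i < n)%nat -> 0 <= f i) -> 0 <= rsum n f.
Proof.
  intros H. rewrite <- (rsum_zero n (fun _ => 0)) by reflexivity. now apply rsum_le.
Qed.

Lemma rsum_term_le (n : nat) (f : nat -> R) (i : nat) :
  (forall j, (j < n)%nat -> 0 <= f j) -> (i < n)%nat -> f i <= rsum n f.
Proof.
  induction n as [|n IH]; intros H Hi; [lia|]. simpl.
  destruct (Nat.eq_dec i n) as [->|Hne].
  - assert (0 <= rsum n f) by (apply rsum_nonneg; intros; apply H; lia). lra.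
  - assert (f i <= rsum n f) by (apply IH; [intros; apply H; lia | lia]).
    assert (0 <= f n) by (apply H; lia). lra.
Qed.

Lemma rsum_pos (n : nat) (f : nat -> R) :
  (1 <= n)%nat -> (forall i, (i < n)%nat -> 0 < f i) -> 0 < rsum n f.
Proof.
  intros Hn H. apply Rlt_le_trans with (f 0%nat); [apply H; lia|].
  apply rsum_term_le; [intros; apply Rlt_le, H|]; lia.
Qed.

Lemma rsum_pos_ex (n : nat) (f : nat -> R) :
  0 < rsum n f -> exists i, (i < n)%nat /\ 0 < f i.
Proof.
  induction n as [|n IH]; simpl; intros H; [lra|].
  destruct (Rlt_dec 0 (f n)) as [Hf|Hf]; [exists n; split; [lia|easy]|].
  destruct IH as [i [Hi Hfi]]; [lra|]. exists i; split; [lia|easy].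
Qed.

Lemma rsum_update (n : nat) (f g : nat -> R) (k : nat) :
  (k < n)%nat -> (forall i, (i < n)%nat -> i <> k -> g i = f i) ->
  rsum n g = rsum n f + (g k - f k).
Proof.
  induction n as [|n IH]; intros Hk H; [lia|]. simpl.
  destruct (Nat.eq_dec k n) as [->|Hne].
  - rewrite (rsum_ext n g f) by (intros; apply H; lia). lra.
  - rewrite IH by (try lia; intros; apply H; lia). rewrite (H n) by lia. lra.
Qed.

Lemma rsum_single (n : nat) (f : nat -> R) (k : nat) :
  (k < n)%nat -> (forall i, (i < n)%nat -> i <> k -> f i = 0) -> rsum n f = f k.
Proof.
  intros Hk H. rewrite (rsum_update n (fun _ => 0) f k Hk H), rsum_const. lra.
Qed.

Lemma rsum_abs_diff (n : nat) (f g h : nat -> R) :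
  (forall i, (i < n)%nat -> Rabs (f i - g i) <= h i) -> Rabs (rsum n f - rsum n g) <= rsum n h.
Proof.
  induction n as [|n IH]; intros H; simpl; [rewrite Rminus_0_r, Rabs_R0; lra|].
  replace (rsum n f + f n - (rsum n g + g n)) with ((rsum n f - rsum n g) + (f n - g n)) by ring.
  apply Rle_trans with (1 := Rabs_triang _ _).
  apply Rplus_le_compat; [apply IH; intros; apply H | apply H]; lia.
Qed.

Lemma rsum2_lin (p q : nat) (a b : R) (f g : nat -> nat -> R) :
  rsum p (fun i => rsum q (fun j => a * f i j + b * g i j))
  = a * rsum p (fun i => rsum q (fun j => f i j)) + b * rsum p (fun i => rsum q (fun j => g i j)).
Proof.
  rewrite <- !rsum_scal, <- rsum_plus. apply rsum_ext. intros i _.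
  rewrite <- !rsum_scal, <- rsum_plus. reflexivity.
Qed.

Lemma rmax_nonneg (n : nat) (f : nat -> R) : 0 <= rmax n f.
Proof. induction n as [|n IH]; simpl; [lra|]. apply Rle_trans with (1 := IH), Rmax_l. Qed.

Lemma rmax_ge (n : nat) (f : nat -> R) (i : nat) : (i < n)%nat -> f i <= rmax n f.
Proof.
  induction n as [|n IH]; intros Hi; [lia|]. simpl.
  destruct (Nat.eq_dec i n) as [->|Hne]; [apply Rmax_r|].
  apply Rle_trans with (rmax n f); [apply IH; lia | apply Rmax_l].
Qed.

Lemma rmax_le (n : nat) (f : nat -> R) (B : R) :
  0 <= B -> (forall i, (i < n)%nat -> f i <= B) -> rmax n f <= B.
Proof.
  intros HB. induction n as [|n IH]; intros H; simpl; [lra|].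
  apply Rmax_lub; [apply IH; intros; apply H|apply H]; lia.
Qed.

Lemma rmax_ext (n : nat) (f g : nat -> R) :
  (forall i, (i < n)%nat -> f i = g i) -> rmax n f = rmax n g.
Proof.
  induction n as [|n IH]; intros H; simpl; [reflexivity|].
  rewrite IH by (intros; apply H; lia). now rewrite H by lia.
Qed.

Lemma rpow_pos_eq (z a : R) : 0 < z -> rpow z a = Rpower z a.
Proof. intros Hz. unfold rpow. now destruct (Rlt_dec 0 z). Qed.

Lemma rpow_0 (a : R) : rpow 0 a = 0.
Proof. unfold rpow. destruct (Rlt_dec 0 0); [lra|reflexivity]. Qed.

Lemma rpow_pos (z a : R) : 0 < z -> 0 < rpow z a.
Proof. intros Hz. rewrite rpow_pos_eq by easy. apply exp_pos. Qed.

Lemma rpow_nonneg (z a : R) : 0 <= rpow z a.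
Proof.
  unfold rpow. destruct (Rlt_dec 0 z); [apply Rlt_le, exp_pos | lra].
Qed.

Lemma rpow_mult (x y a : R) : 0 <= x -> 0 <= y -> rpow (x * y) a = rpow x a * rpow y a.
Proof.
  intros [Hx|<-] [Hy|<-]; rewrite ?Rmult_0_l, ?Rmult_0_r, ?rpow_0; try ring.
  rewrite !rpow_pos_eq by (try apply Rmult_lt_0_compat; easy).
  now rewrite Rpower_mult_distr.
Qed.

Lemma rpow_rpow (x a b : R) : 0 <= x -> rpow (rpow x a) b = rpow x (a * b).
Proof.
  intros [Hx|<-]; [|now rewrite !rpow_0].
  rewrite (rpow_pos_eq _ b) by now apply rpow_pos.
  rewrite !rpow_pos_eq by easy. apply Rpower_mult.
Qed.

Lemma rpow_1 (x : R) : 0 <= x -> rpow x 1 = x.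
Proof.
  intros [Hx|<-]; [|apply rpow_0]. rewrite rpow_pos_eq by easy. now apply Rpower_1.
Qed.

Lemma rpow_plus (x a b : R) : rpow x (a + b) = rpow x a * rpow x b.
Proof.
  unfold rpow. destruct (Rlt_dec 0 x); [apply Rpower_plus | ring].
Qed.

Lemma rpow_le (x y a : R) : 0 <= a -> 0 <= x <= y -> rpow x a <= rpow y a.
Proof.
  intros Ha [[Hx|<-] Hxy]; [|rewrite rpow_0; apply rpow_nonneg].
  rewrite !rpow_pos_eq by lra. apply Rle_Rpower_l; lra.
Qed.

Lemma rpow_inv_r (x p : R) : 0 < p -> 0 <= x -> rpow (rpow x p) (/ p) = x.
Proof.
  intros Hp Hx. rewrite rpow_rpow by easy. rewrite Rinv_r by lra. now apply rpow_1.
Qed.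

Lemma rpow_inv_l (x p : R) : 0 < p -> 0 <= x -> rpow (rpow x (/ p)) p = x.
Proof.
  intros Hp Hx. rewrite rpow_rpow by easy. rewrite Rinv_l by lra. now apply rpow_1.
Qed.

Lemma rpow_exp (c a : R) : rpow (exp c) a = exp (a * c).
Proof. rewrite rpow_pos_eq by apply exp_pos. unfold Rpower. now rewrite ln_exp. Qed.

(** The base must be positive: [rpow] vanishes on the negative axis, so for [a <= 1] it is not
    differentiable at 0. *)
Lemma derivable_pt_lim_rpow (f : R -> R) (t l a : R) :
  0 < f t -> derivable_pt_lim f t l ->
  derivable_pt_lim (fun s => rpow (f s) a) t (a * rpow (f t) (a - 1) * l).
Proof.
  intros Hf Hd. rewrite rpow_pos_eq by easy.
  apply (derivable_pt_lim_comp f (fun z => rpow z a)); [exact Hd|].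
  apply (derivable_pt_lim_locally_ext (fun z => Rpower z a) _ (f t) 0 (f t + 1)); [lra| |].
  - intros z Hz. now rewrite rpow_pos_eq.
  - now apply derivable_pt_lim_power.
Qed.

(* Closeness of nonnegative reals up to a factor [exp c]; unlike
   [|ln x - ln y| <= c] it stays meaningful when both numbers vanish. *)
Definition lc (c x y : R) : Prop := x <= exp c * y /\ y <= exp c * x.

Lemma lc_refl (c x : R) : 0 <= c -> 0 <= x -> lc c x x.
Proof.
  intros Hc Hx. assert (1 <= exp c) by (generalize (exp_ineq1_le c); lra).
  split; nra.
Qed.

Lemma lc_weaken (c c' x y : R) : 0 <= x -> 0 <= y -> c <= c' -> lc c x y -> lc c' x y.
Proof.
  intros Hx Hy Hc [H1 H2].
  assert (exp c <= exp c') by (destruct Hc as [Hc| ->]; [apply Rlt_le, exp_increasing, Hc | lra]).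
  split; nra.
Qed.

Lemma lc_plus (c x y x' y' : R) : lc c x y -> lc c x' y' -> lc c (x + x') (y + y').
Proof. unfold lc; intros [] []; split; lra. Qed.

(** Summation costs nothing, whereas products add their constants; a bound for a gradient entry
    therefore reduces to one for a single summand. *)
Lemma lc_rsum (c : R) (n : nat) (f g : nat -> R) :
  (forall i, (i < n)%nat -> lc c (f i) (g i)) -> lc c (rsum n f) (rsum n g).
Proof.
  induction n as [|n IH]; intros H; simpl; [unfold lc; lra|].
  apply lc_plus; [apply IH; intros; apply H|apply H]; lia.
Qed.

Lemma lc_mult (c c' x y x' y' : R) :
  0 <= x -> 0 <= y -> 0 <= x' -> 0 <= y' ->
  lc c x y -> lc c' x' y' -> lc (c + c') (x * x') (y * y').
Proof.
  intros Hx Hy Hx' Hy' [H1 H2] [H3 H4]. unfold lc. rewrite exp_plus.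
  split.
  - replace (exp c * exp c' * (y * y')) with ((exp c * y) * (exp c' * y')) by ring.
    now apply Rmult_le_compat.
  - replace (exp c * exp c' * (x * x')) with ((exp c * x) * (exp c' * x')) by ring.
    now apply Rmult_le_compat.
Qed.

Lemma lc_scal (c k x y : R) : 0 <= k -> lc c x y -> lc c (k * x) (k * y).
Proof.
  intros Hk [H1 H2]; split.
  - replace (exp c * (k * y)) with (k * (exp c * y)) by ring. now apply Rmult_le_compat_l.
  - replace (exp c * (k * x)) with (k * (exp c * x)) by ring. now apply Rmult_le_compat_l.
Qed.

Lemma lc_rpow (c a x y : R) :
  0 <= a -> 0 <= x -> 0 <= y -> lc c x y -> lc (a * c) (rpow x a) (rpow y a).
Proof.
  intros Ha Hx Hy [H1 H2]. pose proof (exp_pos c). unfold lc.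
  rewrite <- rpow_exp, <- !rpow_mult by lra.
  split; apply rpow_le; lra.
Qed.

Lemma lc_inv (c x y : R) : 0 < x -> 0 < y -> lc c x y -> lc c (/ x) (/ y).
Proof.
  assert (H : forall x y, 0 < x -> 0 < y -> y <= exp c * x -> / x <= exp c * / y).
  { clear; intros x y Hx Hy H. pose proof (Rinv_0_lt_compat x Hx). pose proof (Rinv_0_lt_compat y Hy).
    apply Rmult_le_reg_l with (x * y); [nra|]. field_simplify; lra. }
  intros Hx Hy [H1 H2]; split; apply H; easy.
Qed.

Lemma lc_exp (c s t : R) : Rabs (s - t) <= c -> lc c (exp s) (exp t).
Proof.
  intros H. pose proof (Rle_abs (s - t)). pose proof (Rle_abs (- (s - t))).
  rewrite Rabs_Ropp in *.
  assert (He : forall a b, a <= b -> exp a <= exp b).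
  { intros a b [Hab| ->]; [apply Rlt_le, exp_increasing, Hab | lra]. }
  split; rewrite <- exp_plus; apply He; lra.
Qed.

Lemma lc_abs_ln (c x y : R) :
  0 < x -> 0 < y -> lc c x y <-> Rabs (ln x - ln y) <= c.
Proof.
  intros Hx Hy. split.
  - assert (Hl : forall x y, 0 < x -> 0 < y -> x <= exp c * y -> ln x <= c + ln y).
    { clear; intros x y Hx Hy H. rewrite <- (ln_exp c), <- ln_mult by (try apply exp_pos; easy).
      destruct H as [H|H]; [apply Rlt_le, ln_increasing; easy | rewrite H; lra]. }
    intros [H1 H2]. apply Hl in H1; try easy. apply Hl in H2; try easy.
    apply Rabs_le. lra.
  - intros H. rewrite <- (exp_ln x), <- (exp_ln y) by easy. now apply lc_exp.
Qed.

(** The bound is linear in [c], without [exp c - 1], because the larger number is kept as reference: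
    [y >= exp (- c) * x >= (1 - c) * x]. *)
Lemma lc_abs_diff (c B x y : R) :
  0 <= c -> 0 <= x <= B -> 0 <= y <= B -> lc c x y -> Rabs (x - y) <= B * c.
Proof.
  assert (H : forall x y, 0 <= c -> 0 <= x <= B -> x <= exp c * y -> x - y <= B * c).
  { clear; intros x y Hc Hx H.
    assert (He : exp (- c) * x <= y).
    { rewrite exp_Ropp. pose proof (exp_pos c). apply Rmult_le_reg_l with (exp c); [easy|].
      field_simplify; lra. }
    pose proof (exp_ineq1_le (- c)).
    assert ((1 + - c) * x <= exp (- c) * x) by (apply Rmult_le_compat_r; lra).
    assert (x * c <= B * c) by (apply Rmult_le_compat_r; lra). lra. }
  intros Hc Hx Hy [H1 H2].
  pose proof (H x y Hc Hx H1). pose proof (H y x Hc Hy H2). apply Rabs_le. lra.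
Qed.

Lemma derivable_pt_lim_rsum (n : nat) (f : nat -> R -> R) (l : nat -> R) (t : R) :
  (forall i, (i < n)%nat -> derivable_pt_lim (f i) t (l i)) ->
  derivable_pt_lim (fun s => rsum n (fun i => f i s)) t (rsum n l).
Proof.
  induction n as [|n IH]; intros H; simpl; [apply derivable_pt_lim_const|].
  apply (derivable_pt_lim_plus (fun s => rsum n (fun i => f i s)) (f n)).
  - apply IH; intros; apply H; lia.
  - apply H; lia.
Qed.

Lemma derivable_pt_lim_exp_comp (f : R -> R) (t l : R) :
  derivable_pt_lim f t l -> derivable_pt_lim (fun s => exp (f s)) t (exp (f t) * l).
Proof. intros H. apply (derivable_pt_lim_comp f exp); [exact H | apply derivable_pt_lim_exp]. Qed.

(** * Elementary matrices and curves that move one or two entries *)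

Definition nonneg_mx (p q : nat) (M : nat -> nat -> R) : Prop :=
  forall i j, (i < p)%nat -> (j < q)%nat -> 0 <= M i j.

(** The elementary matrix at [(i, j)], read at [(i', j')]: the direction of a partial derivative. *)
Definition unit_mx (i j i' j' : nat) : R := if andb (Nat.eqb i' i) (Nat.eqb j' j) then 1 else 0.

Definition zero_mx (i j : nat) : R := 0.

Lemma rsum2_unit (p q i j : nat) (c : nat -> nat -> R) : (i < p)%nat -> (j < q)%nat ->
  rsum p (fun i' => rsum q (fun j' => c i' j' * unit_mx i j i' j')) = c i j.
Proof.
  intros Hi Hj. unfold unit_mx. rewrite (rsum_single p _ i Hi).
  - rewrite (rsum_single q _ j Hj); [rewrite !Nat.eqb_refl; simpl; ring|].
    intros j' _ Hne. apply Nat.eqb_neq in Hne as ->. rewrite andb_false_r. ring.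
  - intros i' _ Hne. apply Nat.eqb_neq in Hne as ->. apply rsum_zero. intros; simpl; ring.
Qed.

Lemma rsum2_unit1 (p q i j : nat) : (i < p)%nat -> (j < q)%nat ->
  rsum p (fun i' => rsum q (fun j' => unit_mx i j i' j')) = 1.
Proof.
  intros Hi Hj. rewrite <- (rsum2_unit p q i j (fun _ _ => 1) Hi Hj) at 1.
  apply rsum_ext; intros; apply rsum_ext; intros; ring.
Qed.

Lemma rsum2_zero (p q : nat) : rsum p (fun i => rsum q (fun j => zero_mx i j)) = 0.
Proof. apply rsum_zero; intros; apply rsum_zero; reflexivity. Qed.

Lemma upd_id (M : nat -> nat -> R) (i j : nat) : upd M i j (M i j) = M.
Proof.
  extensionality i'. extensionality j'. unfold upd.
  destruct (Nat.eqb_spec i' i) as [->|], (Nat.eqb_spec j' j) as [->|]; reflexivity.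
Qed.

(** The positions must differ, since otherwise the outer update hides the inner one and the term in
    [dg] would be wrong. *)
Lemma derivable_pt_lim_upd2 (v : nat -> nat -> R) (i j i' j' k l : nat) (f g : R -> R) (t df dg : R) :
  (i, j) <> (i', j') -> derivable_pt_lim f t df -> derivable_pt_lim g t dg ->
  derivable_pt_lim (fun s => upd (upd v i' j' (g s)) i j (f s) k l) t
    (df * unit_mx i j k l + dg * unit_mx i' j' k l).
Proof.
  intros Hne Hf Hg. unfold upd, unit_mx.
  destruct (Nat.eqb_spec k i) as [->|], (Nat.eqb_spec l j) as [->|]; simpl.
  1: { replace (df * 1 + dg * _) with df; [easy|].
       destruct (Nat.eqb_spec i i'), (Nat.eqb_spec j j'); simpl; try ring. congruence. }
  all: destruct (andb _ _); ring_simplify (df * 0 + dg * 1); ring_simplify (df * 0 + dg * 0);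
    [easy | apply derivable_pt_lim_const].
Qed.

Lemma upd2_id (v : nat -> nat -> R) (i j i' j' : nat) :
  upd (upd v i' j' (v i' j')) i j (v i j) = v.
Proof. now rewrite !upd_id. Qed.

Lemma deriv_at_eq (f : R -> R) (t l : R) : derivable_pt_lim f t l -> deriv_at f t = l.
Proof.
  intros H. apply (uniqueness_limite f t); [|exact H].
  unfold deriv_at. apply epsilon_spec. now exists l.
Qed.

Lemma derivable_pt_lim_upd (M : nat -> nat -> R) (i j i' j' : nat) (f : R -> R) (t l : R) :
  derivable_pt_lim f t l ->
  derivable_pt_lim (fun s => upd M i j (f s) i' j') t (l * unit_mx i j i' j').
Proof.
  intros H. unfold upd, unit_mx. destruct (andb (Nat.eqb i' i) (Nat.eqb j' j)).
  - now rewrite Rmult_1_r.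
  - rewrite Rmult_0_r. apply derivable_pt_lim_const.
Qed.

Lemma upd_same (M : nat -> nat -> R) (i j : nat) (t : R) : upd M i j t i j = t.
Proof. unfold upd. now rewrite !Nat.eqb_refl. Qed.

Lemma upd_other (M : nat -> nat -> R) (i j i' j' : nat) (t : R) :
  (i', j') <> (i, j) -> upd M i j t i' j' = M i' j'.
Proof.
  intros H. unfold upd. destruct (Nat.eqb_spec i' i) as [->|], (Nat.eqb_spec j' j) as [->|];
    simpl; congruence.
Qed.

(** * Differentiating the objective *)

Definition preact (d : nat) (u : nat -> nat -> R) (v : nat -> R) (l : nat) : R :=
  rsum d (fun m => u l m * v m).

(* Partial derivative in [f r] of [- loss K y f + rsum K f]. *)
Definition score_grad (K y : nat) (f : nat -> R) (r : nat) : R :=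
  (if Nat.eqb r y then 1 else 0) + 1 - exp (f r) / rsum K (fun j => exp (f j)).

Lemma sum_exp_pos (K : nat) (f : nat -> R) : (1 <= K)%nat -> 0 < rsum K (fun j => exp (f j)).
Proof. intros HK. apply rsum_pos; [exact HK | intros; apply exp_pos]. Qed.

Lemma derivable_pt_lim_score (K y : nat) (f : R -> nat -> R) (df : nat -> R) (t : R) :
  (y < K)%nat -> (forall r, (r < K)%nat -> derivable_pt_lim (fun s => f s r) t (df r)) ->
  derivable_pt_lim (fun s => - loss K y (f s) + rsum K (f s)) t
    (rsum K (fun r => score_grad K y (f t) r * df r)).
Proof.
  intros Hy Hf. unfold loss.
  assert (HS : 0 < rsum K (fun j => exp (f t j))) by (apply sum_exp_pos; lia).
  set (Z := rsum K (fun j => exp (f t j))) in *.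
  replace (rsum K (fun r => score_grad K y (f t) r * df r))
    with (- (- df y + / Z * rsum K (fun j => exp (f t j) * df j)) + rsum K df).
  - apply (derivable_pt_lim_plus (fun s => - (- f s y + ln (rsum K (fun j => exp (f s j)))))
             (fun s => rsum K (f s))).
    + apply (derivable_pt_lim_opp (fun s => - f s y + ln (rsum K (fun j => exp (f s j))))).
      apply (derivable_pt_lim_plus (fun s => - f s y) (fun s => ln (rsum K (fun j => exp (f s j))))).
      * apply (derivable_pt_lim_opp (fun s => f s y)), Hf, Hy.
      * apply (derivable_pt_lim_comp (fun s => rsum K (fun j => exp (f s j))) ln).
        -- apply (derivable_pt_lim_rsum K (fun j s => exp (f s j))).
           intros j Hj. now apply (derivable_pt_lim_exp_comp (fun s => f s j)), Hf.
        -- now apply derivable_pt_lim_ln.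
    + apply (derivable_pt_lim_rsum K (fun j s => f s j)). exact Hf.
  - rewrite (rsum_ext K (fun r => score_grad K y (f t) r * df r)
      (fun r => (if Nat.eqb r y then df r else 0) + df r + - / Z * (exp (f t r) * df r))).
    + rewrite !rsum_plus, rsum_scal, (rsum_single K (fun r => if Nat.eqb r y then df r else 0) y Hy).
      * rewrite Nat.eqb_refl. ring.
      * intros r _ Hr. now apply Nat.eqb_neq in Hr as ->.
    + intros r _. unfold score_grad. fold Z. destruct (Nat.eqb r y); field; lra.
Qed.

(** Writing [1 - exp (f r) / Z] as the sum of the other exponentials over [Z] removes the
    subtraction; nonnegativity and the [lc] calculus then apply. *)
Lemma score_grad_ratio (K y : nat) (f : nat -> R) (r : nat) :
  (r < K)%nat ->
  score_grad K y f r =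
    rsum K (fun s => ((if Nat.eqb r y then 1 else 0) + (if Nat.eqb s r then 0 else 1)) * exp (f s))
    / rsum K (fun s => exp (f s)).
Proof.
  intros Hr. assert (HS : 0 < rsum K (fun s => exp (f s))) by (apply sum_exp_pos; lia).
  set (e := if Nat.eqb r y then 1 else 0).
  rewrite (rsum_ext K (fun s => (e + (if Nat.eqb s r then 0 else 1)) * exp (f s))
    (fun s => (e + 1) * exp (f s) + (if Nat.eqb s r then - exp (f s) else 0))).
  - rewrite rsum_plus, rsum_scal.
    rewrite (rsum_single K (fun s => if Nat.eqb s r then - exp (f s) else 0) r Hr).
    + rewrite Nat.eqb_refl. unfold score_grad. fold e. field. lra.
    + intros s _ Hs. now apply Nat.eqb_neq in Hs as ->.
  - intros s _. destruct (Nat.eqb s r); ring.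
Qed.

Lemma score_grad_nonneg (K y : nat) (f : nat -> R) (r : nat) :
  (r < K)%nat -> 0 <= score_grad K y f r.
Proof.
  intros Hr. rewrite score_grad_ratio by easy. apply Rmult_le_pos.
  - apply rsum_nonneg. intros s _. pose proof (exp_pos (f s)).
    destruct (Nat.eqb r y), (Nat.eqb s r); lra.
  - apply Rlt_le, Rinv_0_lt_compat, sum_exp_pos. lia.
Qed.

(** Numerator and denominator each vary by a factor [exp c], whence the 2. *)
Lemma score_grad_lc (K y : nat) (f g : nat -> R) (r : nat) (c : R) :
  (r < K)%nat -> (forall s, (s < K)%nat -> Rabs (f s - g s) <= c) ->
  lc (2 * c) (score_grad K y f r) (score_grad K y g r).
Proof.
  intros Hr H. rewrite !score_grad_ratio by easy. replace (2 * c) with (c + c) by ring.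
  assert (Hk : forall s, 0 <= (if Nat.eqb r y then 1 else 0) + (if Nat.eqb s r then 0 else 1)).
  { intros s. destruct (Nat.eqb r y), (Nat.eqb s r); lra. }
  assert (Hp : forall h, 0 <= rsum K (fun s => ((if Nat.eqb r y then 1 else 0)
                            + (if Nat.eqb s r then 0 else 1)) * exp (h s))).
  { intros h. apply rsum_nonneg. intros s _. apply Rmult_le_pos; [apply Hk|apply Rlt_le, exp_pos]. }
  assert (HZ : forall h, 0 < rsum K (fun s => exp (h s))) by (intros; apply sum_exp_pos; lia).
  apply lc_mult; try apply Hp; try (apply Rlt_le, Rinv_0_lt_compat, HZ).
  - apply lc_rsum. intros s Hs. now apply lc_scal, lc_exp, H.
  - apply lc_inv; try apply HZ. apply lc_rsum. intros s Hs. now apply lc_exp, H.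
Qed.

(** Log-sum-exp grows by at most the total increase [D] of the outputs, which [rsum K] compensates
    exactly. Arguing without derivatives keeps this valid on the boundary. *)
Lemma score_mono (K y : nat) (f g : nat -> R) :
  (y < K)%nat -> (forall r, (r < K)%nat -> f r <= g r) ->
  - loss K y f + rsum K f <= - loss K y g + rsum K g.
Proof.
  intros Hy H. unfold loss.
  set (D := rsum K (fun r => g r - f r)).
  assert (HD : rsum K g = rsum K f + D).
  { unfold D. rewrite <- rsum_plus. apply rsum_ext. intros; ring. }
  assert (Hr : forall r, (r < K)%nat -> g r <= D + f r).
  { intros r Hr. enough (g r - f r <= D) by lra.
    apply (rsum_term_le K (fun r => g r - f r)); [intros j Hj; specialize (H j Hj); lra | easy]. }
  assert (Hln : ln (rsum K (fun j => exp (g j))) <= D + ln (rsum K (fun j => exp (f j)))).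
  { rewrite <- (ln_exp D) at 1. rewrite <- ln_mult by (try apply exp_pos; apply sum_exp_pos; lia).
    assert (Hle : rsum K (fun j => exp (g j)) <= exp D * rsum K (fun j => exp (f j))).
    { rewrite <- rsum_scal. apply rsum_le. intros j Hj. rewrite <- exp_plus.
      destruct (Hr j Hj) as [Hlt|Heq]; [apply Rlt_le, exp_increasing, Hlt | rewrite Heq; lra]. }
    destruct Hle as [Hlt|Heq]; [|rewrite Heq; lra].
    apply Rlt_le, ln_increasing; [apply sum_exp_pos; lia | exact Hlt]. }
  specialize (H y Hy). lra.
Qed.

(** * Directional derivatives of the objective *)

Section Objective.
Context (n d K n1 : nat) (alpha : nat -> R) (x : nat -> nat -> R) (y : nat -> nat) (eps : R).
Context (Hy : forall i, (i < n)%nat -> (y i < K)%nat).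

Notation PhiF := (Phi n d K n1 alpha x y eps).

Definition coefg (w u : nat -> nat -> R) (i r : nat) : R :=
  score_grad K (y i) (net d n1 alpha w u (x i)) r.

(** Closed form that stands in for the choice-based [grad_w] in all estimates; every summand is
    nonnegative for nonnegative data. *)
Definition gw (w u : nat -> nat -> R) (r l : nat) : R :=
  / INR n * rsum n (fun i => coefg w u i r * rpow (preact d u (x i) l) (alpha l)) + eps.

Definition gu (w u : nat -> nat -> R) (l m : nat) : R :=
  / INR n * rsum n (fun i => rsum K (fun r => coefg w u i r *
      (w r l * (alpha l * rpow (preact d u (x i) l) (alpha l - 1) * x i m)))) + eps.

Definition dnet (w u dw du : nat -> nat -> R) (i r : nat) : R :=
  rsum n1 (fun l => dw r l * rpow (preact d u (x i) l) (alpha l)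
     + w r l * (alpha l * rpow (preact d u (x i) l) (alpha l - 1) * preact d du (x i) l)).

(** The differential as a linear form in [(dw, du)]. One chain rule then serves both the partial
    derivatives, its values on elementary matrices, and the two-entry curves used at a maximizer. *)
Definition DPhi (w u dw du : nat -> nat -> R) : R :=
  / INR n * rsum n (fun i => rsum K (fun r => coefg w u i r * dnet w u dw du i r))
  + eps * (rsum K (fun r => rsum n1 (fun l => dw r l))
           + rsum n1 (fun l => rsum d (fun m => du l m))).

(** The last hypothesis replaces differentiability of the power at 0: a preactivation that is not
    positive has to stay constant along the curve. *)
Lemma derivable_pt_lim_Phi (W U : R -> nat -> nat -> R) (dw du : nat -> nat -> R) (t : R) :
  (forall r l, (r < K)%nat -> (l < n1)%nat -> derivable_pt_lim (fun s => W s r l) t (dw r l)) ->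
  (forall l m, (l < n1)%nat -> (m < d)%nat -> derivable_pt_lim (fun s => U s l m) t (du l m)) ->
  (forall i l, (i < n)%nat -> (l < n1)%nat ->
     0 < preact d (U t) (x i) l \/ forall s, preact d (U s) (x i) l = preact d (U t) (x i) l) ->
  derivable_pt_lim (fun s => PhiF (W s) (U s)) t (DPhi (W t) (U t) dw du).
Proof.
  intros HW HU Hpre. unfold Phi, DPhi.
  assert (Hdpre : forall i l, (i < n)%nat -> (l < n1)%nat ->
            derivable_pt_lim (fun s => preact d (U s) (x i) l) t (preact d du (x i) l)).
  { intros i l Hi Hl. unfold preact.
    apply (derivable_pt_lim_rsum d (fun m s => U s l m * x i m)). intros m Hm.
    apply (derivable_pt_lim_ext (fun s => x i m * U s l m)); [intros; ring|].
    rewrite (Rmult_comm (du l m)). apply (derivable_pt_lim_scal (fun s => U s l m)), HU; easy. }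
  apply (derivable_pt_lim_plus
    (fun s => / INR n * rsum n (fun i => - loss K (y i) (net d n1 alpha (W s) (U s) (x i))
                 + rsum K (fun r => net d n1 alpha (W s) (U s) (x i) r)))
    (fun s => eps * (rsum K (fun r => rsum n1 (fun l => W s r l))
                     + rsum n1 (fun l => rsum d (fun m => U s l m))))).
  - apply (derivable_pt_lim_scal (fun s => rsum n (fun i =>
      - loss K (y i) (net d n1 alpha (W s) (U s) (x i))
      + rsum K (fun r => net d n1 alpha (W s) (U s) (x i) r)))).
    apply (derivable_pt_lim_rsum n (fun i s => - loss K (y i) (net d n1 alpha (W s) (U s) (x i))
      + rsum K (fun r => net d n1 alpha (W s) (U s) (x i) r))).
    intros i Hi. unfold coefg.
    apply (derivable_pt_lim_score K (y i) (fun s => net d n1 alpha (W s) (U s) (x i)));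
      [now apply Hy|].
    intros r Hr. unfold net, dnet.
    apply (derivable_pt_lim_rsum n1 (fun l s => W s r l * rpow (preact d (U s) (x i) l) (alpha l))).
    intros l Hl.
    apply (derivable_pt_lim_mult (fun s => W s r l) (fun s => rpow (preact d (U s) (x i) l) (alpha l)));
      [now apply HW|].
    destruct (Hpre i l Hi Hl) as [Hp|Hc].
    + apply (derivable_pt_lim_rpow (fun s => preact d (U s) (x i) l)); auto.
    + apply (derivable_pt_lim_ext (fun _ => rpow (preact d (U t) (x i) l) (alpha l)));
        [intros s; now rewrite (Hc s)|].
      (* The formal derivative of a constant preactivation is 0 by uniqueness of derivatives, so the
         formula is right whatever value the power [alpha l - 1] takes. *)
      replace (preact d du (x i) l) with 0; [rewrite Rmult_0_r; apply derivable_pt_lim_const|].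
      apply (uniqueness_limite (fun s => preact d (U s) (x i) l) t); [|now apply Hdpre].
      apply (derivable_pt_lim_ext (fun _ => preact d (U t) (x i) l)); [intros s; now rewrite (Hc s)|].
      apply derivable_pt_lim_const.
  - apply (derivable_pt_lim_scal (fun s => rsum K (fun r => rsum n1 (fun l => W s r l))
                     + rsum n1 (fun l => rsum d (fun m => U s l m)))).
    apply (derivable_pt_lim_plus (fun s => rsum K (fun r => rsum n1 (fun l => W s r l)))
             (fun s => rsum n1 (fun l => rsum d (fun m => U s l m)))).
    + apply (derivable_pt_lim_rsum K (fun r s => rsum n1 (fun l => W s r l))). intros r Hr.
      apply (derivable_pt_lim_rsum n1 (fun l s => W s r l)). auto.
    + apply (derivable_pt_lim_rsum n1 (fun l s => rsum d (fun m => U s l m))). intros l Hl.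
      apply (derivable_pt_lim_rsum d (fun m s => U s l m)). auto.
Qed.

Lemma pre_lin (a b : R) (u1 u2 : nat -> nat -> R) (v : nat -> R) (l : nat) :
  preact d (fun l m => a * u1 l m + b * u2 l m) v l = a * preact d u1 v l + b * preact d u2 v l.
Proof.
  unfold preact. rewrite <- !rsum_scal, <- rsum_plus. apply rsum_ext. intros; ring.
Qed.

Lemma DPhi_lin (w u dw1 du1 dw2 du2 : nat -> nat -> R) (a b : R) :
  DPhi w u (fun r l => a * dw1 r l + b * dw2 r l) (fun l m => a * du1 l m + b * du2 l m)
  = a * DPhi w u dw1 du1 + b * DPhi w u dw2 du2.
Proof.
  unfold DPhi. rewrite !rsum2_lin.
  rewrite (rsum_ext n _ (fun i => rsum K (fun r => a * (coefg w u i r * dnet w u dw1 du1 i r)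
             + b * (coefg w u i r * dnet w u dw2 du2 i r)))); [rewrite rsum2_lin; ring|].
  intros i _. apply rsum_ext. intros r _.
  transitivity (coefg w u i r * (a * dnet w u dw1 du1 i r + b * dnet w u dw2 du2 i r)); [|ring].
  f_equal. unfold dnet. rewrite <- !rsum_scal, <- rsum_plus. apply rsum_ext. intros l _.
  rewrite pre_lin. ring.
Qed.

Lemma DPhi_unit_w (w u : nat -> nat -> R) (r l : nat) : (r < K)%nat -> (l < n1)%nat ->
  DPhi w u (unit_mx r l) zero_mx = gw w u r l.
Proof.
  intros Hr Hl. unfold DPhi, gw.
  rewrite rsum2_unit1, rsum2_zero, Rplus_0_r, Rmult_1_r by easy. f_equal. f_equal.
  apply rsum_ext. intros i _.
  rewrite <- (rsum2_unit K n1 r l (fun r l => coefg w u i r * rpow (preact d u (x i) l) (alpha l)) Hr Hl).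
  apply rsum_ext. intros r' _. unfold dnet. rewrite <- rsum_scal. apply rsum_ext. intros l' _.
  replace (preact d zero_mx (x i) l') with 0; [ring|].
  symmetry. apply rsum_zero. intros; unfold zero_mx; ring.
Qed.

Lemma pre_unit (l m l' : nat) (v : nat -> R) : (m < d)%nat ->
  preact d (unit_mx l m) v l' = if Nat.eqb l' l then v m else 0.
Proof.
  intros Hm. unfold preact, unit_mx. destruct (Nat.eqb l' l); simpl.
  - rewrite (rsum_single d _ m Hm); [rewrite Nat.eqb_refl; ring|].
    intros j _ Hne. apply Nat.eqb_neq in Hne as ->. ring.
  - apply rsum_zero. intros; ring.
Qed.

Lemma DPhi_unit_u (w u : nat -> nat -> R) (l m : nat) : (l < n1)%nat -> (m < d)%nat ->
  DPhi w u zero_mx (unit_mx l m) = gu w u l m.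
Proof.
  intros Hl Hm. unfold DPhi, gu.
  rewrite rsum2_unit1, rsum2_zero, Rplus_0_l, Rmult_1_r by easy. f_equal. f_equal.
  apply rsum_ext. intros i _. apply rsum_ext. intros r _. f_equal. unfold dnet.
  rewrite (rsum_single n1 _ l Hl).
  - rewrite pre_unit, Nat.eqb_refl by easy. unfold zero_mx. ring.
  - intros l' _ Hne. rewrite pre_unit by easy. apply Nat.eqb_neq in Hne as ->. unfold zero_mx. ring.
Qed.

End Objective.

(** * Gradient formulas, lower bounds and monotonicity for nonnegative parameters *)

Section Gradient.
Context (n d K n1 : nat) (alpha : nat -> R) (x : nat -> nat -> R) (y : nat -> nat) (eps : R).
Context (Hn : (1 <= n)%nat) (Heps : 0 < eps).
Context (Hx : forall i m, (i < n)%nat -> (m < d)%nat -> 0 <= x i m).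
Context (Hy : forall i, (i < n)%nat -> (y i < K)%nat).
Context (Halpha : forall l, (l < n1)%nat -> 1 <= alpha l).

Notation PhiF := (Phi n d K n1 alpha x y eps).
Notation gwF := (gw n d K n1 alpha x y eps).
Notation guF := (gu n d K n1 alpha x y eps).
Notation DPhiF := (DPhi n d K n1 alpha x y eps).
Notation coefgF := (coefg d K n1 alpha x y).

Lemma pre_nonneg (u : nat -> nat -> R) (i l : nat) :
  nonneg_mx n1 d u -> (i < n)%nat -> (l < n1)%nat -> 0 <= preact d u (x i) l.
Proof.
  intros Hu Hi Hl. apply rsum_nonneg. intros m Hm. apply Rmult_le_pos; [apply Hu | apply Hx]; easy.
Qed.

(* This is what keeps [s |-> s^alpha] differentiable along the curves below,
   although [preact] may vanish when [x i] does or when [u] lies on the boundary. *)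
Lemma pre_pos_or_const (U : R -> nat -> nat -> R) (t : R) (i l : nat) :
  nonneg_mx n1 d (U t) ->
  (forall l m, (l < n1)%nat -> (m < d)%nat -> 0 < U t l m \/ forall s, U s l m = U t l m) ->
  (i < n)%nat -> (l < n1)%nat ->
  0 < preact d (U t) (x i) l \/ forall s, preact d (U s) (x i) l = preact d (U t) (x i) l.
Proof.
  intros Hu HU Hi Hl.
  destruct (classic (exists m, (m < d)%nat /\ 0 < U t l m * x i m)) as [[m [Hm Hpos]]|Hno].
  - left. apply Rlt_le_trans with (1 := Hpos).
    apply (rsum_term_le d (fun m => U t l m * x i m)); [|easy].
    intros j Hj. apply Rmult_le_pos; [apply Hu | apply Hx]; easy.
  - right. intros s. apply rsum_ext. intros m Hm.
    destruct (HU l m Hl Hm) as [Hpos|Hc]; [|now rewrite Hc].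
    destruct (Hx i m Hi Hm) as [Hxp|Hx0]; [|rewrite <- Hx0; ring].
    exfalso. apply Hno. exists m. split; [easy | now apply Rmult_lt_0_compat].
Qed.

Lemma grad_w_eq (w u : nat -> nat -> R) (r l : nat) : nonneg_mx n1 d u ->
  (r < K)%nat -> (l < n1)%nat -> grad_w PhiF w u r l = gwF w u r l.
Proof.
  intros Hu Hr Hl. unfold grad_w. apply deriv_at_eq. rewrite <- DPhi_unit_w by easy.
  rewrite <- (upd_id w r l) at 2.
  apply (derivable_pt_lim_Phi n d K n1 alpha x y eps Hy (fun s => upd w r l s) (fun _ => u)).
  - intros r' l' _ _. rewrite <- (Rmult_1_l (unit_mx r l r' l')).
    apply derivable_pt_lim_upd, derivable_pt_lim_id.
  - intros l' m' _ _. apply derivable_pt_lim_const.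
  - intros; now right.
Qed.

(** Moving an entry that is 0 could drive a preactivation through 0, where the power is cut off;
    hence the positivity of [u l m]. *)
Lemma grad_u_eq (w u : nat -> nat -> R) (l m : nat) : nonneg_mx n1 d u -> 0 < u l m ->
  (l < n1)%nat -> (m < d)%nat -> grad_u PhiF w u l m = guF w u l m.
Proof.
  intros Hu Hp Hl Hm. unfold grad_u. apply deriv_at_eq. rewrite <- DPhi_unit_u by easy.
  rewrite <- (upd_id u l m) at 2.
  apply (derivable_pt_lim_Phi n d K n1 alpha x y eps Hy (fun _ => w) (fun s => upd u l m s)).
  - intros l' m' _ _. apply derivable_pt_lim_const.
  - intros r' l' _ _. rewrite <- (Rmult_1_l (unit_mx l m r' l')).
    apply derivable_pt_lim_upd, derivable_pt_lim_id.
  - intros i l' Hi Hl'. apply (pre_pos_or_const (fun s => upd u l m s)); [| |easy|easy].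
    + now rewrite upd_id.
    + intros l'' m'' _ _. unfold upd.
      destruct (Nat.eqb_spec l'' l), (Nat.eqb_spec m'' m); simpl; auto.
Qed.

Lemma coefg_nonneg (w u : nat -> nat -> R) (i r : nat) : (r < K)%nat -> 0 <= coefgF w u i r.
Proof. apply score_grad_nonneg. Qed.

Lemma inv_INR_pos : 0 < / INR n.
Proof. apply Rinv_0_lt_compat, lt_0_INR. lia. Qed.

(** The regulariser supplies the bound; the data part is merely nonnegative and vanishes, for
    instance, when all inputs do. *)
Lemma gw_ge_eps (w u : nat -> nat -> R) (r l : nat) : (r < K)%nat -> eps <= gwF w u r l.
Proof.
  intros Hr. unfold gw. enough (0 <= / INR n * rsum n (fun i =>
    coefgF w u i r * rpow (preact d u (x i) l) (alpha l))) by lra.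
  apply Rmult_le_pos; [apply Rlt_le, inv_INR_pos|]. apply rsum_nonneg. intros i _.
  apply Rmult_le_pos; [now apply coefg_nonneg | apply rpow_nonneg].
Qed.

Lemma gu_ge_eps (w u : nat -> nat -> R) (l m : nat) :
  nonneg_mx K n1 w -> (l < n1)%nat -> (m < d)%nat -> eps <= guF w u l m.
Proof.
  intros Hw Hl Hm. unfold gu. match goal with |- _ <= ?a + _ => enough (0 <= a) by lra end.
  apply Rmult_le_pos; [apply Rlt_le, inv_INR_pos|]. apply rsum_nonneg. intros i Hi.
  apply rsum_nonneg. intros r Hr. apply Rmult_le_pos; [now apply coefg_nonneg|].
  pose proof (Halpha l Hl).
  repeat apply Rmult_le_pos; auto; try lra. apply rpow_nonneg.
Qed.

Definition entry_sum (w u : nat -> nat -> R) : R :=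
  rsum K (fun r => rsum n1 (fun l => w r l)) + rsum n1 (fun l => rsum d (fun m => u l m)).

(** Growth at rate [eps], stated by differences because it is applied at zero entries, where a
    derivative may be missing. *)
Lemma Phi_mono (w u w' u' : nat -> nat -> R) :
  nonneg_mx K n1 w -> nonneg_mx n1 d u ->
  (forall r l, (r < K)%nat -> (l < n1)%nat -> w r l <= w' r l) ->
  (forall l m, (l < n1)%nat -> (m < d)%nat -> u l m <= u' l m) ->
  PhiF w u + eps * (entry_sum w' u' - entry_sum w u) <= PhiF w' u'.
Proof.
  intros Hw Hu Hww Huu. unfold Phi. fold (entry_sum w u) (entry_sum w' u').
  rewrite Rmult_minus_distr_l.
  match goal with |- ?a + _ + _ <= ?b + _ => enough (a <= b) by lra end.
  apply Rmult_le_compat_l; [apply Rlt_le, inv_INR_pos|].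
  apply rsum_le. intros i Hi. apply score_mono; [now apply Hy|]. intros r Hr.
  apply rsum_le. intros l Hl. pose proof (Halpha l Hl).
  apply Rmult_le_compat; [now apply Hw | apply rpow_nonneg | now apply Hww|].
  apply rpow_le; [lra|]. split; [now apply pre_nonneg|].
  apply rsum_le. intros m Hm. apply Rmult_le_compat_r; [now apply Hx | now apply Huu].
Qed.

Context (rw ru : R) (Hrw : 0 < rw) (Hru : 0 < ru).

(** What the gradient estimates take from strict feasibility: positivity and the entry bounds that
    the norm constraints imply. *)
Definition box (w u : nat -> nat -> R) : Prop :=
  (forall r l, (r < K)%nat -> (l < n1)%nat -> 0 < w r l <= rw) /\
  (forall l m, (l < n1)%nat -> (m < d)%nat -> 0 < u l m <= ru).

Lemma rho_x_nonneg : 0 <= rho_x n d x.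
Proof. apply rmax_nonneg. Qed.

Lemma pre_le (w u : nat -> nat -> R) (i l : nat) : box w u -> (i < n)%nat -> (l < n1)%nat ->
  preact d u (x i) l <= ru * rho_x n d x.
Proof.
  intros [_ Hu] Hi Hl. apply Rle_trans with (ru * norm1 d (x i)).
  - unfold norm1. rewrite <- rsum_scal. apply rsum_le. intros m Hm.
    apply Rmult_le_compat; [apply Rlt_le; now apply Hu | now apply Hx | now apply Hu | apply Rle_abs].
  - apply Rmult_le_compat_l; [lra|]. now apply (rmax_ge n (fun i => norm1 d (x i))).
Qed.

Lemma xi1_nonneg : 0 <= xi1 n d n1 alpha x rw ru.
Proof. apply Rmult_le_pos; [lra|]. apply rsum_nonneg; intros; apply rpow_nonneg. Qed.

Lemma xi2_nonneg : 0 <= xi2 n d n1 alpha x rw ru.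
Proof.
  apply Rmult_le_pos; [lra|]. apply rsum_nonneg; intros l Hl. pose proof (Halpha l Hl).
  apply Rmult_le_pos; [lra | apply rpow_nonneg].
Qed.

Lemma alpha_le_inf (l : nat) : (l < n1)%nat -> alpha l <= alpha_inf n1 alpha.
Proof.
  intros Hl. apply Rle_trans with (1 := Rle_abs _).
  now apply (rmax_ge n1 (fun l => Rabs (alpha l))).
Qed.

(** * Logarithmic variation of the gradient between two points *)

Section TwoPoints.
Context (w u w' u' : nat -> nat -> R) (a : nat -> R) (b : R).
Context (Hbox : box w u) (Hbox' : box w' u').
Context (Ha : forall r, (r < K)%nat -> 0 <= a r) (Hb : 0 <= b).
Context (Hwa : forall r l, (r < K)%nat -> (l < n1)%nat -> lc (a r) (w r l) (w' r l)).
Context (Hub : forall l m, (l < n1)%nat -> (m < d)%nat -> lc b (u l m) (u' l m)).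

Notation X1 := (xi1 n d n1 alpha x rw ru).
Notation X2 := (xi2 n d n1 alpha x rw ru).
Notation AI := (alpha_inf n1 alpha).

Lemma box_nonneg_w (v z : nat -> nat -> R) : box v z -> nonneg_mx K n1 v.
Proof. intros [H _] r l Hr Hl. apply Rlt_le. now apply H. Qed.

Lemma box_nonneg_u (v z : nat -> nat -> R) : box v z -> nonneg_mx n1 d z.
Proof. intros [_ H] r l Hr Hl. apply Rlt_le. now apply H. Qed.

Lemma pre_lc (i l : nat) : (i < n)%nat -> (l < n1)%nat ->
  lc b (preact d u (x i) l) (preact d u' (x i) l).
Proof.
  intros Hi Hl. apply lc_rsum. intros m Hm.
  rewrite (Rmult_comm (u l m)), (Rmult_comm (u' l m)). apply lc_scal; auto.
Qed.

Lemma pre_rpow_lc (i l : nat) (e : R) : 0 <= e -> (i < n)%nat -> (l < n1)%nat ->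
  lc (e * b) (rpow (preact d u (x i) l) e) (rpow (preact d u' (x i) l) e).
Proof.
  intros He Hi Hl. apply lc_rpow; [easy| | |now apply pre_lc];
    apply pre_nonneg; auto; eapply box_nonneg_u; eauto.
Qed.

(** Origin of [xi1] and [xi2]: the size of a summand times its logarithmic variation
    [a r + alpha l * b], summed over the hidden units. *)
Lemma net_diff (i r : nat) : (i < n)%nat -> (r < K)%nat ->
  Rabs (net d n1 alpha w u (x i) r - net d n1 alpha w' u' (x i) r) <= X1 * a r + X2 * b.
Proof.
  intros Hi Hr. pose proof rho_x_nonneg.
  apply Rle_trans with (rsum n1 (fun l =>
    rw * rpow (ru * rho_x n d x) (alpha l) * (a r + alpha l * b))).
  - apply rsum_abs_diff. intros l Hl. pose proof (Halpha l Hl). fold (preact d u (x i) l) (preact d u' (x i) l).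
    assert (Hbd : forall v z, box v z ->
      0 <= v r l * rpow (preact d z (x i) l) (alpha l) <= rw * rpow (ru * rho_x n d x) (alpha l)).
    { intros v z Hvz. pose proof (proj1 Hvz r l Hr Hl). split.
      - apply Rmult_le_pos; [lra | apply rpow_nonneg].
      - apply Rmult_le_compat; [lra | apply rpow_nonneg | lra|]. apply rpow_le; [lra|]. split.
        + apply pre_nonneg; auto. eapply box_nonneg_u; eauto.
        + eapply pre_le; eauto. }
    assert (0 <= alpha l * b) by (apply Rmult_le_pos; lra).
    apply lc_abs_diff; [specialize (Ha r Hr); lra | now apply Hbd | now apply Hbd |].
    apply lc_mult; try apply rpow_nonneg.
    + now apply (box_nonneg_w w u).
    + now apply (box_nonneg_w w' u').
    + now apply Hwa.
    + apply pre_rpow_lc; try easy. lra.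
  - right. unfold xi1, xi2.
    rewrite (rsum_ext n1 _ (fun l => rw * a r * rpow (ru * rho_x n d x) (alpha l)
       + rw * b * (alpha l * rpow (ru * rho_x n d x) (alpha l)))) by (intros; ring).
    rewrite rsum_plus, !rsum_scal. ring.
Qed.

(** The softmax couples all classes, so each [a s] is replaced by the whole sum. This is why the
    first [K] entries in a row of [A] are equal. *)
Lemma coefg_lc (i r : nat) : (i < n)%nat -> (r < K)%nat ->
  lc (2 * X1 * rsum K a + 2 * X2 * b) (coefgF w u i r) (coefgF w' u' i r).
Proof.
  intros Hi Hr. replace (2 * X1 * rsum K a + 2 * X2 * b) with (2 * (X1 * rsum K a + X2 * b)) by ring.
  apply score_grad_lc; [easy|]. intros s Hs. apply Rle_trans with (1 := net_diff i s Hi Hs).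
  apply Rplus_le_compat_r, Rmult_le_compat_l; [apply xi1_nonneg|]. now apply rsum_term_le.
Qed.

Lemma lc_plus_eps (c z z' : R) : 0 <= c -> lc c z z' -> lc c (z + eps) (z' + eps).
Proof. intros Hc H. apply lc_plus; [easy | apply lc_refl; lra]. Qed.

Lemma gw_lc (r l : nat) : (r < K)%nat -> (l < n1)%nat ->
  lc (2 * X1 * rsum K a + (2 * X2 + AI) * b) (gwF w u r l) (gwF w' u' r l).
Proof.
  intros Hr Hl. pose proof xi1_nonneg. pose proof xi2_nonneg.
  assert (0 <= rsum K a) by now apply rsum_nonneg.
  pose proof (Halpha l Hl). pose proof (alpha_le_inf l Hl).
  assert (0 <= X1 * rsum K a) by (apply Rmult_le_pos; lra).
  assert (0 <= (2 * X2 + AI) * b) by (apply Rmult_le_pos; lra).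
  apply lc_plus_eps; [lra|]. apply lc_scal; [apply Rlt_le, inv_INR_pos|].
  apply lc_rsum. intros i Hi.
  apply lc_weaken with ((2 * X1 * rsum K a + 2 * X2 * b) + alpha l * b).
  1, 2: apply Rmult_le_pos; [now apply coefg_nonneg | apply rpow_nonneg].
  - assert (alpha l * b <= AI * b) by (apply Rmult_le_compat_r; lra). lra.
  - apply lc_mult; try apply rpow_nonneg; try now apply coefg_nonneg.
    + now apply coefg_lc.
    + apply pre_rpow_lc; try easy. lra.
Qed.

(** Compared with [gw_lc], the extra factor [w r l] contributes the [+ 1], and the exponent
    [alpha l - 1] in place of [alpha l] contributes the [- 1]. *)
Lemma gu_lc (l m : nat) : (l < n1)%nat -> (m < d)%nat ->
  lc ((2 * X1 + 1) * rsum K a + (2 * X2 + AI - 1) * b) (guF w u l m) (guF w' u' l m).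
Proof.
  intros Hl Hm. pose proof xi1_nonneg. pose proof xi2_nonneg.
  assert (0 <= rsum K a) by now apply rsum_nonneg.
  pose proof (Halpha l Hl). pose proof (alpha_le_inf l Hl).
  assert (0 <= (2 * X1 + 1) * rsum K a) by (apply Rmult_le_pos; lra).
  assert (0 <= (2 * X2 + AI - 1) * b) by (apply Rmult_le_pos; lra).
  apply lc_plus_eps; [lra|]. apply lc_scal; [apply Rlt_le, inv_INR_pos|].
  apply lc_rsum. intros i Hi. apply lc_rsum. intros r Hr.
  assert (Hp : forall v z, box v z ->
     0 <= alpha l * rpow (preact d z (x i) l) (alpha l - 1) * x i m).
  { intros v z _. apply Rmult_le_pos; [|now apply Hx].
    apply Rmult_le_pos; [lra | apply rpow_nonneg]. }
  assert (Hq : forall v z, box v z ->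
     0 <= v r l * (alpha l * rpow (preact d z (x i) l) (alpha l - 1) * x i m)).
  { intros v z Hvz. apply Rmult_le_pos; [now apply (box_nonneg_w v z) | now apply (Hp v z)]. }
  pose proof (Hp w u Hbox). pose proof (Hp w' u' Hbox').
  pose proof (Hq w u Hbox). pose proof (Hq w' u' Hbox').
  apply lc_weaken with ((2 * X1 * rsum K a + 2 * X2 * b) + (a r + (alpha l - 1) * b)).
  1, 2: apply Rmult_le_pos; [now apply coefg_nonneg | easy].
  - assert ((alpha l - 1) * b <= (AI - 1) * b) by (apply Rmult_le_compat_r; lra).
    assert (a r <= rsum K a) by now apply rsum_term_le. lra.
  - apply lc_mult; try easy; try now apply coefg_nonneg.
    + now apply coefg_lc.
    + apply lc_mult; try easy.
      * now apply (box_nonneg_w w u).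
      * now apply (box_nonneg_w w' u').
      * now apply Hwa.
      * rewrite !(Rmult_comm _ (x i m)). apply lc_scal; [now apply Hx|].
        apply lc_scal; [lra|]. apply pre_rpow_lc; try easy. lra.
Qed.

End TwoPoints.
End Gradient.

(** Constancy on blocks lifts an eigenvector of the quotient matrix to one of [A], so its Perron
    root is at most [rho]. The factor [INR K] reflects that [s] stands for a sum of [K] row
    distances obeying one common bound. *)
Lemma block_matrix_perron (K : nat) (A : nat -> nat -> R) (a11 a12 a21 a22 rho : R) :
  (1 <= K)%nat -> 0 <= a11 -> 0 < a12 -> 0 < a21 -> 0 <= a22 ->
  (forall i j, (i < K)%nat -> (j < K)%nat -> A i j = a11) ->
  (forall i, (i < K)%nat -> A i K = a12) ->
  (forall j, (j < K)%nat -> A K j = a21) -> A K K = a22 ->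
  is_spectral_radius (S K) A rho ->
  exists g1 g2, 0 < g1 /\ 0 < g2 /\ 0 < rho /\
    forall s b s' b', 0 <= s -> 0 <= b ->
      s' <= INR K * (a11 * s + a12 * b) -> b' <= a21 * s + a22 * b ->
      g1 * s' + g2 * b' <= rho * (g1 * s + g2 * b).
Proof.
  intros HK H11 H12 H21 H22 E11 E12 E21 E22 [_ Hsr].
  assert (HK0 : 0 < INR K) by (apply lt_0_INR; lia).
  (* [lam] is the Perron root of the quotient matrix [[K a11, K a12], [a21, a22]]. *)
  set (B11 := INR K * a11).
  set (D := (B11 - a22) * (B11 - a22) + 4 * (INR K * a12 * a21)).
  assert (HB11 : 0 <= B11) by (apply Rmult_le_pos; lra).
  assert (Hprod : 0 < INR K * a12 * a21) by (repeat apply Rmult_lt_0_compat; lra).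
  assert (HD : 0 <= D) by (pose proof (Rle_0_sqr (B11 - a22)) as Hs; unfold Rsqr in Hs; unfold D; lra).
  pose proof (sqrt_sqrt D HD) as Hsq. pose proof (sqrt_pos D) as Hsp.
  set (lam := (B11 + a22 + sqrt D) / 2).
  assert (Hchar : (lam - B11) * (lam - a22) = INR K * a12 * a21).
  { transitivity ((sqrt D * sqrt D - (B11 - a22) * (B11 - a22)) / 4); [unfold lam; field|].
    rewrite Hsq. unfold D. field. }
  (* Strict because the off-diagonal entries are positive; this makes the weight [lam - B11]
     positive and, as [0 <= B11], also [rho]. *)
  assert (Hgap : 0 < lam - B11).
  { assert (B11 - a22 < sqrt D) by (unfold D in *; nra). unfold lam. lra. }
  assert (Hlam : lam <= rho).
  { replace lam with (cmod (lam, 0)).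
    (* The right eigenvector [(a12, lam - B11)] of the quotient, repeated over the first block. *)
    - apply Hsr. exists (fun i => if Nat.ltb i K then (a12, 0) else (lam - B11, 0)). split.
      + exists 0%nat. split; [lia|]. destruct (Nat.ltb_spec 0 K); [|lia].
        intros He; injection He; lra.
      + assert (Hrow : forall i c1 c2, (forall j, (j < K)%nat -> A i j = c1) -> A i K = c2 ->
          rsum (S K) (fun j => A i j * fst (if Nat.ltb j K then (a12, 0) else (lam - B11, 0)))
          = INR K * (c1 * a12) + c2 * (lam - B11) /\
          rsum (S K) (fun j => A i j * snd (if Nat.ltb j K then (a12, 0) else (lam - B11, 0))) = 0).
        { intros i c1 c2 H1 H2. split.
          - simpl. rewrite Nat.ltb_irrefl, H2, <- rsum_const. f_equal.
            apply rsum_ext. intros j Hj. rewrite H1 by easy. now apply Nat.ltb_lt in Hj as ->.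
          - apply rsum_zero. intros j _. destruct (Nat.ltb j K); simpl; ring. }
        intros i Hi. destruct (Nat.ltb_spec i K) as [HiK|HiK].
        * destruct (Hrow i a11 a12) as [-> ->]; [intros; now apply E11 | now apply E12|].
          simpl. unfold B11. split; ring.
        * assert (i = K) as -> by lia.
          destruct (Hrow K a21 a22) as [-> ->]; [exact E21 | exact E22|].
          simpl. split; [|ring]. rewrite Rmult_0_l, Rminus_0_r. lra.
    - unfold cmod. simpl. rewrite Rmult_0_l, Rplus_0_r. apply sqrt_square. lra. }
  (* These weights form the left eigenvector of the quotient for [lam]; being positive, they may
     multiply the two inequalities. *)
  exists a21, (lam - B11). repeat split; try lra.
  intros s b s' b' Hs Hb Hs' Hb'.
  apply Rle_trans with (lam * (a21 * s + (lam - B11) * b)).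
  - apply Rle_trans with (a21 * (INR K * (a11 * s + a12 * b)) + (lam - B11) * (a21 * s + a22 * b)).
    + apply Rplus_le_compat; apply Rmult_le_compat_l; lra.
    + right. transitivity (lam * a21 * s + (INR K * a12 * a21 + (lam - B11) * a22) * b);
        [unfold B11; ring|]. rewrite <- Hchar. ring.
  - apply Rmult_le_compat_r; [|exact Hlam].
    apply Rplus_le_le_0_compat; apply Rmult_le_pos; lra.
Qed.

(** Treating a row as a matrix with one row lets each norm lemma serve both the rows of [w] and the
    whole of [u]. *)
Lemma pnorm_as_mx (p : R) (n : nat) (v : nat -> R) : pnorm p n v = pnorm_mx p 1 n (fun _ => v).
Proof. unfold pnorm, pnorm_mx. simpl. now rewrite Rplus_0_l. Qed.

(** * Entrywise p-norms and normalisation *)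

Section EntrywiseNorm.
Context (p : R) (N M : nat) (Hp : 1 < p).

Lemma pnorm_mx_ext (v v' : nat -> nat -> R) :
  (forall i j, (i < N)%nat -> (j < M)%nat -> v i j = v' i j) ->
  pnorm_mx p N M v = pnorm_mx p N M v'.
Proof.
  intros H. unfold pnorm_mx. f_equal. apply rsum_ext; intros; apply rsum_ext; intros.
  now rewrite H.
Qed.

Lemma power_sum_nonneg (v : nat -> nat -> R) :
  0 <= rsum N (fun i => rsum M (fun j => rpow (Rabs (v i j)) p)).
Proof. repeat (apply rsum_nonneg; intros). apply rpow_nonneg. Qed.

Lemma pnorm_mx_entry_le (v : nat -> nat -> R) (i j : nat) :
  (i < N)%nat -> (j < M)%nat -> Rabs (v i j) <= pnorm_mx p N M v.
Proof.
  intros Hi Hj. rewrite <- (rpow_inv_r (Rabs (v i j)) p) by (try apply Rabs_pos; lra).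
  apply rpow_le; [apply Rlt_le, Rinv_0_lt_compat; lra|]. split; [apply rpow_nonneg|].
  apply Rle_trans with (rsum M (fun j => rpow (Rabs (v i j)) p)).
  - apply (rsum_term_le M (fun j => rpow (Rabs (v i j)) p)); [intros; apply rpow_nonneg | easy].
  - apply (rsum_term_le N (fun i => rsum M (fun j => rpow (Rabs (v i j)) p)));
      [intros; apply rsum_nonneg; intros; apply rpow_nonneg | easy].
Qed.

Lemma pnorm_mx_scal (c : R) (v : nat -> nat -> R) : 0 <= c ->
  pnorm_mx p N M (fun i j => c * v i j) = c * pnorm_mx p N M v.
Proof.
  intros Hc. unfold pnorm_mx.
  rewrite (rsum_ext N _ (fun i => rpow c p * rsum M (fun j => rpow (Rabs (v i j)) p))).
  - rewrite rsum_scal, rpow_mult, rpow_inv_r; try easy; try lra;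
      [apply rpow_nonneg | apply power_sum_nonneg].
  - intros i _. rewrite <- rsum_scal. apply rsum_ext. intros j _.
    rewrite Rabs_mult, rpow_mult, (Rabs_pos_eq c); auto using Rabs_pos.
Qed.

Lemma pnorm_mx_pos (v : nat -> nat -> R) : (1 <= N)%nat -> (1 <= M)%nat ->
  (forall i j, (i < N)%nat -> (j < M)%nat -> 0 < v i j) -> 0 < pnorm_mx p N M v.
Proof.
  intros HN HM Hv. apply rpow_pos. apply rsum_pos; [easy|]. intros i Hi.
  apply rsum_pos; [easy|]. intros j Hj. apply rpow_pos. apply Rabs_pos_lt.
  specialize (Hv i j Hi Hj). lra.
Qed.

Lemma pnorm_mx_normalized (rho : R) (v : nat -> nat -> R) : 0 < rho -> 0 < pnorm_mx p N M v ->
  pnorm_mx p N M (fun i j => rho * v i j / pnorm_mx p N M v) = rho.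
Proof.
  intros Hr Hv. set (c := pnorm_mx p N M v) in *.
  rewrite (pnorm_mx_ext _ (fun i j => (rho / c) * v i j)) by (intros; field; lra).
  rewrite pnorm_mx_scal by (apply Rlt_le, Rdiv_lt_0_compat; lra). fold c. field. lra.
Qed.

(** The entry varies by [c] and its norm, homogeneous of degree 1, by another [c]: the factor 2 in
    every entry of [A]. *)
Lemma normalized_lc (rho c : R) (v v' : nat -> nat -> R) : (1 <= N)%nat -> (1 <= M)%nat -> 0 < rho ->
  (forall i j, (i < N)%nat -> (j < M)%nat -> 0 < v i j) ->
  (forall i j, (i < N)%nat -> (j < M)%nat -> 0 < v' i j) ->
  (forall i j, (i < N)%nat -> (j < M)%nat -> lc c (v i j) (v' i j)) ->
  forall i j, (i < N)%nat -> (j < M)%nat ->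
    lc (2 * c) (rho * v i j / pnorm_mx p N M v) (rho * v' i j / pnorm_mx p N M v').
Proof.
  intros HN HM Hr Hv Hv' H i j Hi Hj. pose proof (Hv i j Hi Hj). pose proof (Hv' i j Hi Hj).
  pose proof (pnorm_mx_pos v HN HM Hv) as P. pose proof (pnorm_mx_pos v' HN HM Hv') as P'.
  replace (2 * c) with (c + c) by ring.
  apply lc_mult; try (apply Rlt_le, Rinv_0_lt_compat; easy); try (apply Rmult_le_pos; lra).
  - apply lc_scal; [lra | auto].
  - apply lc_inv; try easy. replace c with (/ p * (p * c)) by (field; lra).
    apply lc_rpow; try apply power_sum_nonneg; [apply Rlt_le, Rinv_0_lt_compat; lra|].
    repeat (apply lc_rsum; intros).
    rewrite !Rabs_pos_eq by (apply Rlt_le; auto).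
    apply lc_rpow; try (apply Rlt_le; auto; fail); [lra | auto].
Qed.

End EntrywiseNorm.

(** So the power applied by [psi (conj_exp p)] inverts the power [p - 1] of the optimality
    conditions. *)
Lemma conj_exp_minus_1 (p : R) : 1 < p -> conj_exp p - 1 = / (p - 1).
Proof. intros Hp. unfold conj_exp. field. lra. Qed.

Lemma conj_exp_gt_1 (p : R) : 1 < p -> 0 < conj_exp p - 1.
Proof. intros Hp. rewrite conj_exp_minus_1 by easy. apply Rinv_0_lt_compat. lra. Qed.

Lemma psi_pos (p z : R) : 0 < z -> psi p z = rpow z (p - 1).
Proof. intros Hz. unfold psi. destruct (Rlt_dec 0 z); [reflexivity | lra]. Qed.

(** * The map G contracts *)

Section Contraction.
Context (n d K n1 : nat) (alpha : nat -> R) (x : nat -> nat -> R) (y : nat -> nat) (eps : R).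
Context (Hn : (1 <= n)%nat) (Hd : (1 <= d)%nat) (Hn1 : (1 <= n1)%nat) (Heps : 0 < eps).
Context (Hx : forall i m, (i < n)%nat -> (m < d)%nat -> 0 <= x i m).
Context (Hy : forall i, (i < n)%nat -> (y i < K)%nat).
Context (Halpha : forall l, (l < n1)%nat -> 1 <= alpha l).
Context (pw pu rw ru : R) (Hpw : 1 < pw) (Hpu : 1 < pu) (Hrw : 0 < rw) (Hru : 0 < ru).

Notation PhiF := (Phi n d K n1 alpha x y eps).
Notation gwF := (gw n d K n1 alpha x y eps).
Notation guF := (gu n d K n1 alpha x y eps).
Notation Spp := (in_Splusplus K n1 d pw pu rw ru).
Notation Sp := (in_Splus K n1 d pw pu rw ru).
Notation GF := (GPhi PhiF n1 d pw pu rw ru).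

Lemma Spp_Sp (w u : nat -> nat -> R) : Spp w u -> Sp w u.
Proof. intros (H1 & H2 & H3 & H4). repeat split; auto; intros; apply Rlt_le; auto. Qed.

Lemma Sp_entries_le (w u : nat -> nat -> R) : Sp w u ->
  (forall r l, (r < K)%nat -> (l < n1)%nat -> 0 <= w r l <= rw) /\
  (forall l m, (l < n1)%nat -> (m < d)%nat -> 0 <= u l m <= ru).
Proof using Hpw Hpu.
  intros (H1 & H2 & H3 & H4). split; intros i j Hi Hj; (split; [now auto|]);
    apply Rle_trans with (1 := Rle_abs _).
  - rewrite <- (H4 i Hi), pnorm_as_mx.
    apply (pnorm_mx_entry_le pw 1 n1 Hpw (fun _ => w i) 0 j); [exact Nat.lt_0_1 | easy].
  - rewrite <- H3. now apply pnorm_mx_entry_le.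
Qed.

Lemma Spp_box (w u : nat -> nat -> R) : Spp w u -> box d K n1 rw ru w u.
Proof.
  intros H. destruct (Sp_entries_le w u (Spp_Sp w u H)) as [H1 H2].
  destruct H as (H3 & H4 & _). split; intros i j Hi Hj.
  - split; [auto | now apply H1].
  - split; [auto | now apply H2].
Qed.

Definition raww (w u : nat -> nat -> R) (r l : nat) : R := rpow (gwF w u r l) (conj_exp pw - 1).

Definition rawu (w u : nat -> nat -> R) (l m : nat) : R := rpow (guF w u l m) (conj_exp pu - 1).

Lemma raww_pos (w u : nat -> nat -> R) (r l : nat) : (r < K)%nat -> 0 < raww w u r l.
Proof.
  intros Hr. apply rpow_pos. apply Rlt_le_trans with (1 := Heps). now apply gw_ge_eps.
Qed.

Lemma rawu_pos (w u : nat -> nat -> R) (l m : nat) : Spp w u ->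
  (l < n1)%nat -> (m < d)%nat -> 0 < rawu w u l m.
Proof.
  intros H Hl Hm. apply rpow_pos. apply Rlt_le_trans with (1 := Heps).
  apply gu_ge_eps; auto. intros r' l' Hr' Hl'. apply Rlt_le. now apply H.
Qed.

Lemma G_w_eq (w u : nat -> nat -> R) (r l : nat) : Spp w u -> (r < K)%nat -> (l < n1)%nat ->
  fst (GF (w, u)) r l = rw * raww w u r l / pnorm_mx pw 1 n1 (fun _ => raww w u r).
Proof.
  intros H Hr Hl. simpl. rewrite pnorm_as_mx.
  assert (E : forall l, (l < n1)%nat -> psi (conj_exp pw) (grad_w PhiF w u r l) = raww w u r l).
  { intros l' Hl'. rewrite grad_w_eq; auto.
    - apply psi_pos. apply Rlt_le_trans with (1 := Heps). now apply gw_ge_eps.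
    - intros i j Hi Hj. apply Rlt_le. now apply H. }
  rewrite E by easy. f_equal. apply pnorm_mx_ext. auto.
Qed.

Lemma G_u_eq (w u : nat -> nat -> R) (l m : nat) : Spp w u -> (l < n1)%nat -> (m < d)%nat ->
  snd (GF (w, u)) l m = ru * rawu w u l m / pnorm_mx pu n1 d (rawu w u).
Proof.
  intros H Hl Hm. simpl.
  assert (E : forall l m, (l < n1)%nat -> (m < d)%nat ->
    psi (conj_exp pu) (grad_u PhiF w u l m) = rawu w u l m).
  { intros l' m' Hl' Hm'. rewrite grad_u_eq; auto.
    - apply psi_pos. apply Rlt_le_trans with (1 := Heps). apply gu_ge_eps; auto.
      intros i j Hi Hj. apply Rlt_le. now apply H.
    - intros i j Hi Hj. apply Rlt_le. now apply H.
    - now apply H. }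
  rewrite E by easy. f_equal. apply pnorm_mx_ext. auto.
Qed.

Lemma raww_norm_pos (w u : nat -> nat -> R) (r : nat) : (r < K)%nat ->
  0 < pnorm_mx pw 1 n1 (fun _ => raww w u r).
Proof. intros Hr. apply pnorm_mx_pos; auto. intros; now apply raww_pos. Qed.

Lemma rawu_norm_pos (w u : nat -> nat -> R) : Spp w u -> 0 < pnorm_mx pu n1 d (rawu w u).
Proof. intros H. apply pnorm_mx_pos; auto. intros; now apply rawu_pos. Qed.

Lemma G_preserves_Spp (w u : nat -> nat -> R) : Spp w u ->
  Spp (fst (GF (w, u))) (snd (GF (w, u))).
Proof.
  intros H. split; [|split; [|split]].
  - intros r l Hr Hl. rewrite G_w_eq by easy. apply Rdiv_lt_0_compat; [|now apply raww_norm_pos].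
    apply Rmult_lt_0_compat; [easy | now apply raww_pos].
  - intros l m Hl Hm. rewrite G_u_eq by easy. apply Rdiv_lt_0_compat; [|now apply rawu_norm_pos].
    apply Rmult_lt_0_compat; [easy | now apply rawu_pos].
  - rewrite (pnorm_mx_ext pu n1 d _ _ (fun l m => G_u_eq w u l m H)).
    apply pnorm_mx_normalized; auto. now apply rawu_norm_pos.
  - intros r Hr. rewrite pnorm_as_mx.
    etransitivity; [exact (pnorm_mx_ext pw 1 n1 _ _ (fun _ l _ Hl => G_w_eq w u r l H Hr Hl))|].
    apply (pnorm_mx_normalized pw 1 n1 Hpw rw (fun _ => raww w u r)); auto.
    now apply raww_norm_pos.
Qed.

(** On positive vectors this is Thompson's metric. *)
Definition logdist_row (w w' : nat -> nat -> R) (r : nat) : R :=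
  rmax n1 (fun l => Rabs (ln (w r l) - ln (w' r l))).

Definition logdist_u (u u' : nat -> nat -> R) : R :=
  rmax n1 (fun l => rmax d (fun m => Rabs (ln (u l m) - ln (u' l m)))).

Lemma logdist_row_lc (w w' : nat -> nat -> R) (r l : nat) :
  (l < n1)%nat -> 0 < w r l -> 0 < w' r l -> lc (logdist_row w w' r) (w r l) (w' r l).
Proof.
  intros Hl H H'. apply lc_abs_ln; auto. now apply (rmax_ge n1 (fun l => Rabs (ln (w r l) - ln (w' r l)))).
Qed.

Lemma logdist_u_lc (u u' : nat -> nat -> R) (l m : nat) :
  (l < n1)%nat -> (m < d)%nat -> 0 < u l m -> 0 < u' l m -> lc (logdist_u u u') (u l m) (u' l m).
Proof.
  intros Hl Hm H H'. apply lc_abs_ln; auto.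
  apply Rle_trans with (rmax d (fun m => Rabs (ln (u l m) - ln (u' l m)))).
  - now apply (rmax_ge d (fun m => Rabs (ln (u l m) - ln (u' l m)))).
  - now apply (rmax_ge n1 (fun l => rmax d (fun m => Rabs (ln (u l m) - ln (u' l m))))).
Qed.

Lemma logdist_row_nonneg (w w' : nat -> nat -> R) (r : nat) : 0 <= logdist_row w w' r.
Proof. apply rmax_nonneg. Qed.

Lemma logdist_u_nonneg (u u' : nat -> nat -> R) : 0 <= logdist_u u u'.
Proof. apply rmax_nonneg. Qed.

Notation A := (Amat n d K n1 alpha x pw pu rw ru).

(** The indices [0] and [K] represent the two blocks, so four entries of [A] carry all of its
    constants. *)
Lemma G_logdist (w u w' u' : nat -> nat -> R) : Spp w u -> Spp w' u' ->
  let s := rsum K (logdist_row w w') in let b := logdist_u u u' in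
  (forall r, (r < K)%nat ->
     logdist_row (fst (GF (w, u))) (fst (GF (w', u'))) r <= A 0%nat 0%nat * s + A 0%nat K * b) /\
  logdist_u (snd (GF (w, u))) (snd (GF (w', u'))) <= A K 0%nat * s + A K K * b.
Proof.
  intros H H' s b.
  assert (Hs : 0 <= s) by (apply rsum_nonneg; intros; apply logdist_row_nonneg).
  assert (Hb : 0 <= b) by apply logdist_u_nonneg.
  (* There is a first sample, and its label is a class. *)
  assert (HK : (1 <= K)%nat) by (specialize (Hy 0%nat); lia).
  pose proof (conj_exp_gt_1 pw Hpw) as Qw. pose proof (conj_exp_gt_1 pu Hpu) as Qu.
  pose proof (xi1_nonneg n d n1 alpha x rw ru Hrw) as X1.
  pose proof (xi2_nonneg n d n1 alpha x Halpha rw ru Hrw) as X2.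
  assert (HAI : 1 <= alpha_inf n1 alpha).
  { apply Rle_trans with (alpha 0%nat); [now apply Halpha | now apply alpha_le_inf]. }
  assert (Hwa : forall r l, (r < K)%nat -> (l < n1)%nat -> lc (logdist_row w w' r) (w r l) (w' r l)).
  { intros r l Hr Hl. apply logdist_row_lc; [easy | now apply H | now apply H']. }
  assert (Hub : forall l m, (l < n1)%nat -> (m < d)%nat -> lc b (u l m) (u' l m)).
  { intros l m Hl Hm. apply logdist_u_lc; try easy; [now apply H | now apply H']. }
  unfold Amat. rewrite Nat.ltb_irrefl. destruct (Nat.ltb_spec 0 K); [|lia]. split.
  - intros r Hr. apply rmax_le.
    { apply Rplus_le_le_0_compat; repeat (assumption || apply Rmult_le_pos); lra. }
    intros l Hl. apply lc_abs_ln; [now apply (G_preserves_Spp w u) | now apply (G_preserves_Spp w' u')|].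
    rewrite !G_w_eq by easy.
    (* The bound is factored as it arises: 2 from the normalisation, [conj_exp pw - 1] from the
       power, the rest from [gw_lc]. *)
    match goal with |- lc ?c _ _ => replace c with (2 * ((conj_exp pw - 1) *
      (2 * xi1 n d n1 alpha x rw ru * s + (2 * xi2 n d n1 alpha x rw ru + alpha_inf n1 alpha) * b)))
      by ring end.
    apply (normalized_lc pw 1 n1 Hpw rw _ (fun _ => raww w u r) (fun _ => raww w' u' r)) with (i := 0%nat); auto;
      try (intros; now apply raww_pos).
    intros _ l' _ Hl'.
    apply lc_rpow; try lra; try (apply Rle_trans with eps; [lra | now apply gw_ge_eps]).
    apply gw_lc; auto using Spp_box. intros; apply logdist_row_nonneg.
  - apply rmax_le.
    { apply Rplus_le_le_0_compat; repeat (assumption || apply Rmult_le_pos); lra. }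
    intros l Hl. apply rmax_le.
    { apply Rplus_le_le_0_compat; repeat (assumption || apply Rmult_le_pos); lra. }
    intros m Hm. apply lc_abs_ln; [now apply (G_preserves_Spp w u) | now apply (G_preserves_Spp w' u')|].
    rewrite !G_u_eq by easy.
    match goal with |- lc ?c _ _ => replace c with (2 * ((conj_exp pu - 1) *
      ((2 * xi1 n d n1 alpha x rw ru + 1) * s
       + (2 * xi2 n d n1 alpha x rw ru + alpha_inf n1 alpha - 1) * b))) by ring end.
    apply normalized_lc; auto; try (intros; now apply rawu_pos).
    intros l' m' Hl' Hm'.
    assert (Hnn : forall v z, Spp v z -> 0 <= guF v z l' m').
    { intros v z Hv. apply Rle_trans with eps; [lra|]. apply gu_ge_eps; auto.
      intros i j Hi Hj. apply Rlt_le. now apply Hv. }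
    apply lc_rpow; try lra; auto.
    apply gu_lc with (a := logdist_row w w'); auto using Spp_box. intros; apply logdist_row_nonneg.
Qed.

Lemma G_contraction (rhoA : R) : is_spectral_radius (S K) A rhoA ->
  exists g1 g2, 0 < g1 /\ 0 < g2 /\ 0 < rhoA /\ forall w u w' u', Spp w u -> Spp w' u' ->
    g1 * rsum K (logdist_row (fst (GF (w, u))) (fst (GF (w', u'))))
      + g2 * logdist_u (snd (GF (w, u))) (snd (GF (w', u')))
    <= rhoA * (g1 * rsum K (logdist_row w w') + g2 * logdist_u u u').
Proof.
  intros Hrho.
  assert (HK : (1 <= K)%nat) by (specialize (Hy 0%nat); lia).
  pose proof (conj_exp_gt_1 pw Hpw) as Qw. pose proof (conj_exp_gt_1 pu Hpu) as Qu.
  pose proof (xi1_nonneg n d n1 alpha x rw ru Hrw) as X1.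
  pose proof (xi2_nonneg n d n1 alpha x Halpha rw ru Hrw) as X2.
  assert (HAI : 1 <= alpha_inf n1 alpha).
  { apply Rle_trans with (alpha 0%nat); [now apply Halpha | now apply alpha_le_inf]. }
  destruct (block_matrix_perron K A (A 0%nat 0%nat) (A 0%nat K) (A K 0%nat) (A K K) rhoA HK)
    as (g1 & g2 & Hg1 & Hg2 & Hr & H); auto.
  1-8: unfold Amat; rewrite ?Nat.ltb_irrefl; destruct (Nat.ltb_spec 0 K); try lia.
  - repeat (assumption || apply Rmult_le_pos); lra.
  - repeat apply Rmult_lt_0_compat; lra.
  - repeat apply Rmult_lt_0_compat; lra.
  - repeat (assumption || apply Rmult_le_pos); lra.
  - intros i j Hi Hj. apply Nat.ltb_lt in Hi as ->. now apply Nat.ltb_lt in Hj as ->.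
  - intros i Hi. now apply Nat.ltb_lt in Hi as ->.
  - intros i Hi. now apply Nat.ltb_lt in Hi as ->.
  - exists g1, g2. repeat split; auto. intros w u w' u' Hz Hz'.
    destruct (G_logdist w u w' u' Hz Hz') as [HA HB]. apply H; auto.
    + apply rsum_nonneg; intros; apply logdist_row_nonneg.
    + apply logdist_u_nonneg.
    + rewrite <- rsum_const. now apply rsum_le.
Qed.

End Contraction.

(** * Compactness and existence of a maximizer *)

Lemma Un_cv_const (c : R) : Un_cv (fun _ => c) c.
Proof. intros e He. exists 0%nat. intros. unfold Rdist. now rewrite Rminus_diag, Rabs_R0. Qed.

Lemma Un_cv_subseq (v : nat -> R) (l : R) (phi : nat -> nat) :
  (forall k, (k <= phi k)%nat) -> Un_cv v l -> Un_cv (fun k => v (phi k)) l.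
Proof.
  intros Hphi H e He. destruct (H e He) as [N HN]. exists N. intros k Hk. apply HN.
  specialize (Hphi k). lia.
Qed.

Lemma Un_cv_rsum (n : nat) (v : nat -> nat -> R) (l : nat -> R) :
  (forall i, (i < n)%nat -> Un_cv (fun k => v k i) (l i)) ->
  Un_cv (fun k => rsum n (v k)) (rsum n l).
Proof.
  induction n as [|n IH]; intros H; simpl; [apply Un_cv_const|].
  apply (CV_plus (fun k => rsum n (v k)) (fun k => v k n)); [apply IH; intros; apply H | apply H]; lia.
Qed.

(** The limit 0 needs its own argument, since the power may fail to be differentiable there; it does
    occur, as limits of feasible points can lie on the boundary. *)
Lemma Un_cv_rpow (v : nat -> R) (l a : R) : 0 < a -> (forall k, 0 <= v k) -> 0 <= l ->
  Un_cv v l -> Un_cv (fun k => rpow (v k) a) (rpow l a).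
Proof.
  intros Ha Hv [Hl|<-] H.
  - apply (continuity_seq (fun z => rpow z a)); [|exact H].
    apply derivable_continuous_pt. exists (a * rpow l (a - 1) * 1).
    apply (derivable_pt_lim_rpow (fun z => z)); [exact Hl | apply derivable_pt_lim_id].
  - intros e He.
    destruct (H (rpow (e / 2) (/ a))) as [N HN]; [apply rpow_pos; lra|].
    exists N. intros k Hk. specialize (HN k Hk). unfold Rdist in *.
    rewrite rpow_0. rewrite Rminus_0_r in *. rewrite Rabs_pos_eq in * by (apply rpow_nonneg || apply Hv).
    apply Rle_lt_trans with (e / 2); [|lra].
    rewrite <- (rpow_inv_l (e / 2) a) by lra. apply rpow_le; [lra|]. split; [apply Hv | lra].
Qed.

Lemma Un_cv_exp (v : nat -> R) (l : R) : Un_cv v l -> Un_cv (fun k => exp (v k)) (exp l).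
Proof. apply (continuity_seq exp), derivable_continuous_pt, derivable_pt_exp. Qed.

Lemma Un_cv_ln (v : nat -> R) (l : R) : 0 < l -> Un_cv v l -> Un_cv (fun k => ln (v k)) (ln l).
Proof.
  intros Hl. apply (continuity_seq ln), derivable_continuous_pt.
  exists (/ l). now apply derivable_pt_lim_ln.
Qed.

Lemma Un_cv_nonneg (v : nat -> R) (l : R) : (forall k, 0 <= v k) -> Un_cv v l -> 0 <= l.
Proof. intros Hv Hcv. exact (@Rle_cv_lim (fun _ => 0) v 0 l Hv (Un_cv_const 0) Hcv). Qed.

(** Asking only [k <= phi k] of the extraction, not strict growth, suffices for limits and is stable
    under composition. *)
Lemma bounded_cv_subseq (v : nat -> R) (a b : R) : (forall k, a <= v k <= b) ->
  exists phi l, (forall k, (k <= phi k)%nat) /\ Un_cv (fun k => v (phi k)) l.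
Proof.
  intros H. destruct (Bolzano_Weierstrass v (fun z => a <= z <= b) (compact_P3 a b) H) as [l Hl].
  assert (Hk : forall k, exists j, (k <= j)%nat /\ Rdist (v j) l < / (INR k + 1)).
  { intros k. assert (Hp : 0 < / (INR k + 1)) by (pose proof (pos_INR k); apply Rinv_0_lt_compat; lra).
    apply (Hl (disc l (mkposreal _ Hp)) k). exists (mkposreal _ Hp). intros z Hz; exact Hz. }
  exists (fun k => epsilon (inhabits 0%nat) (fun j => (k <= j)%nat /\ Rdist (v j) l < / (INR k + 1))), l.
  assert (Hs : forall k, let j := epsilon (inhabits 0%nat)
     (fun j => (k <= j)%nat /\ Rdist (v j) l < / (INR k + 1)) in
     (k <= j)%nat /\ Rdist (v j) l < / (INR k + 1)) by (intros k; apply epsilon_spec, Hk).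
  split; [intros k; apply Hs|]. intros e He.
  destruct (archimed_cor1 e He) as [N [HN HN0]]. exists N. intros k HkN.
  apply Rlt_trans with (1 := proj2 (Hs k)). apply Rle_lt_trans with (2 := HN).
  assert (0 < INR N) by now apply lt_0_INR. assert (INR N <= INR k) by now apply le_INR.
  apply Rinv_le_contravar; lra.
Qed.

(** A finite list of coordinate functionals lets a single induction, with one further extraction per
    coordinate, treat [w] and [u] together. *)
Lemma coordinates_cv_subseq (T : Type) (z : nat -> T) (cs : list (T -> R)) (B : R) :
  (forall c, In c cs -> forall k, 0 <= c (z k) <= B) ->
  exists phi, (forall k, (k <= phi k)%nat) /\
    forall c, In c cs -> exists l, Un_cv (fun k => c (z (phi k))) l.
Proof.
  induction cs as [|c cs IH]; intros H.
  - exists (fun k => k). split; [lia|]. intros c [].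
  - destruct IH as [phi [Hphi Hcv]]; [intros; apply H; now right|].
    destruct (bounded_cv_subseq (fun k => c (z (phi k))) 0 B) as (psi & l & Hpsi & Hl).
    { intros k. apply H. now left. }
    exists (fun k => phi (psi k)). split.
    + intros k. specialize (Hphi (psi k)). specialize (Hpsi k). lia.
    + intros c' [<-|Hin]; [now exists l|].
      destruct (Hcv c' Hin) as [l' Hl']. exists l'.
      now apply (Un_cv_subseq (fun k => c' (z (phi k)))).
Qed.

(** Sequential compactness enters only through the values of [F], so [T] carries no topology. If [F]
    were unbounded, a sequence with [F (z k) > k] would contradict convergence along the
    extraction. *)
Lemma max_attained (T : Type) (X : T -> Prop) (F : T -> R) : (exists z, X z) ->
  (forall z : nat -> T, (forall k, X (z k)) -> exists (phi : nat -> nat) zl,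
     (forall k, (k <= phi k)%nat) /\ X zl /\ Un_cv (fun k => F (z (phi k))) (F zl)) ->
  exists zl, X zl /\ forall z, X z -> F z <= F zl.
Proof.
  intros [z0 Hz0] Hseq. set (E := fun r => exists z, X z /\ r = F z).
  assert (Hchoose : forall P : nat -> T -> Prop, (forall k, exists z, P k z) ->
            exists z : nat -> T, forall k, P k (z k)).
  { intros P HP. exists (fun k => epsilon (inhabits z0) (P k)). intros k. apply epsilon_spec, HP. }
  destruct (classic (bound E)) as [Hb|Hnb].
  - destruct (completeness E Hb (ex_intro _ _ (ex_intro _ z0 (conj Hz0 eq_refl)))) as [m [Hub Hlub]].
    destruct (Hchoose (fun k z => X z /\ m - / (INR k + 1) <= F z)) as [z Hz].
    { intros k. apply NNPP. intros Hno.
      assert (0 < / (INR k + 1)) by (pose proof (pos_INR k); apply Rinv_0_lt_compat; lra).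
      enough (m <= m - / (INR k + 1)) by lra. apply Hlub. intros r [z [Hz ->]].
      apply Rnot_lt_le. intros Hlt. apply Hno. exists z. split; [easy | lra]. }
    destruct (Hseq z) as (phi & zl & Hphi & HXl & Hcv); [intros; apply Hz|].
    exists zl. split; [easy|]. intros z' Hz'.
    apply Rle_trans with m; [apply Hub; now exists z'|].
    refine (@Rle_cv_lim (fun k => m - / (INR (phi k) + 1)) (fun k => F (z (phi k))) _ _ _ _ Hcv);
      [intros; apply Hz|].
    apply (Un_cv_subseq (fun k => m - / (INR k + 1))); [easy|].
    rewrite <- (Rminus_0_r m) at 1. apply CV_minus; [apply Un_cv_const|].
    intros e He. destruct (archimed_cor1 e He) as [N [HN HN0]]. exists N. intros k Hk.
    assert (0 < INR N) by now apply lt_0_INR. assert (INR N <= INR k) by now apply le_INR.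
    unfold Rdist. rewrite Rminus_0_r, Rabs_pos_eq by (apply Rlt_le, Rinv_0_lt_compat; lra).
    apply Rle_lt_trans with (2 := HN). apply Rinv_le_contravar; lra.
  - destruct (Hchoose (fun k z => X z /\ INR k < F z)) as [z Hz].
    { intros k. apply NNPP. intros Hno. apply Hnb. exists (INR k). intros r [z [Hz ->]].
      apply Rnot_lt_le. intros Hlt. apply Hno. now exists z. }
    destruct (Hseq z) as (phi & zl & Hphi & HXl & Hcv); [intros; apply Hz|]. exfalso.
    destruct (Hcv 1 Rlt_0_1) as [N HN]. destruct (INR_unbounded (F zl + 1)) as [M HM].
    specialize (HN (max N M) (Nat.le_max_l _ _)). apply Rabs_def2 in HN.
    destruct (Hz (phi (max N M))) as [_ Hgt]. specialize (Hphi (max N M)).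
    assert (INR M <= INR (phi (max N M))) by (apply le_INR; lia). lra.
Qed.

(** * Continuity of the objective, closedness of the feasible set and a maximizer *)

Section Existence.
Context (n d K n1 : nat) (alpha : nat -> R) (x : nat -> nat -> R) (y : nat -> nat) (eps : R).
Context (Hn : (1 <= n)%nat) (Hd : (1 <= d)%nat) (Hn1 : (1 <= n1)%nat) (Heps : 0 < eps).
Context (Hx : forall i m, (i < n)%nat -> (m < d)%nat -> 0 <= x i m).
Context (Hy : forall i, (i < n)%nat -> (y i < K)%nat).
Context (Halpha : forall l, (l < n1)%nat -> 1 <= alpha l).
Context (pw pu rw ru : R) (Hpw : 1 < pw) (Hpu : 1 < pu) (Hrw : 0 < rw) (Hru : 0 < ru).

Notation PhiF := (Phi n d K n1 alpha x y eps).
Notation Sp := (in_Splus K n1 d pw pu rw ru).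

Definition mx_cv (p q : nat) (M : nat -> nat -> nat -> R) (M' : nat -> nat -> R) : Prop :=
  forall i j, (i < p)%nat -> (j < q)%nat -> Un_cv (fun k => M k i j) (M' i j).

Lemma Phi_cv (w u : nat -> nat -> nat -> R) (wl ul : nat -> nat -> R) :
  (forall k, nonneg_mx n1 d (u k)) -> nonneg_mx n1 d ul ->
  mx_cv K n1 w wl -> mx_cv n1 d u ul -> Un_cv (fun k => PhiF (w k) (u k)) (PhiF wl ul).
Proof.
  intros Hnk Hnl Hw Hu. unfold Phi.
  assert (Hnet : forall i r, (i < n)%nat -> (r < K)%nat ->
    Un_cv (fun k => net d n1 alpha (w k) (u k) (x i) r) (net d n1 alpha wl ul (x i) r)).
  { intros i r Hi Hr. apply Un_cv_rsum. intros l Hl. apply CV_mult; [now apply Hw|].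
    apply Un_cv_rpow.
    - specialize (Halpha l Hl). lra.
    - intros k. now apply (pre_nonneg n d n1 x Hx).
    - now apply (pre_nonneg n d n1 x Hx).
    - apply (Un_cv_rsum d (fun k m => u k l m * x i m)). intros m Hm.
      apply (CV_mult (fun k => u k l m)); [now apply Hu | apply Un_cv_const]. }
  apply CV_plus; (apply CV_mult; [apply Un_cv_const|]).
  - apply (Un_cv_rsum n (fun k i => - loss K (y i) (net d n1 alpha (w k) (u k) (x i))
      + rsum K (fun r => net d n1 alpha (w k) (u k) (x i) r))). intros i Hi.
    apply CV_plus.
    + apply CV_opp. unfold loss. apply CV_plus.
      * apply CV_opp. apply Hnet; auto.
      * apply Un_cv_ln; [apply sum_exp_pos; specialize (Hy i Hi); lia|].
        apply (Un_cv_rsum K (fun k j => exp (net d n1 alpha (w k) (u k) (x i) j))). intros j Hj.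
        now apply Un_cv_exp, Hnet.
    + apply (Un_cv_rsum K (fun k => net d n1 alpha (w k) (u k) (x i))). auto.
  - apply CV_plus.
    + apply (Un_cv_rsum K (fun k r => rsum n1 (fun l => w k r l))). intros r Hr.
      apply (Un_cv_rsum n1 (fun k l => w k r l)). intros l Hl. now apply Hw.
    + apply (Un_cv_rsum n1 (fun k l => rsum d (fun m => u k l m))). intros l Hl.
      apply (Un_cv_rsum d (fun k m => u k l m)). intros m Hm. now apply Hu.
Qed.

Lemma pnorm_mx_cv (p : R) (N M : nat) (v : nat -> nat -> nat -> R) (vl : nat -> nat -> R) :
  1 < p -> mx_cv N M v vl -> Un_cv (fun k => pnorm_mx p N M (v k)) (pnorm_mx p N M vl).
Proof.
  intros Hp H. apply Un_cv_rpow; try (intros; apply power_sum_nonneg); [apply Rinv_0_lt_compat; lra|].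
  apply (Un_cv_rsum N (fun k i => rsum M (fun j => rpow (Rabs (v k i j)) p))). intros i Hi.
  apply (Un_cv_rsum M (fun k j => rpow (Rabs (v k i j)) p)). intros j Hj.
  apply Un_cv_rpow; try (intros; apply Rabs_pos); [lra|]. now apply cv_cvabs, H.
Qed.

Lemma Sp_closed (w u : nat -> nat -> nat -> R) (wl ul : nat -> nat -> R) :
  (forall k, Sp (w k) (u k)) -> mx_cv K n1 w wl -> mx_cv n1 d u ul -> Sp wl ul.
Proof.
  intros H Hw Hu. split; [|split; [|split]].
  - intros r l Hr Hl. apply (Un_cv_nonneg (fun k => w k r l)); [intros; now apply H | now apply Hw].
  - intros l m Hl Hm. apply (Un_cv_nonneg (fun k => u k l m)); [intros; now apply H | now apply Hu].
  - apply (UL_sequence (fun k => pnorm_mx pu n1 d (u k))); [now apply pnorm_mx_cv|].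
    replace (fun k => pnorm_mx pu n1 d (u k)) with (fun _ : nat => ru); [apply Un_cv_const|].
    extensionality k. symmetry. apply H.
  - intros r Hr. rewrite pnorm_as_mx.
    apply (UL_sequence (fun k => pnorm_mx pw 1 n1 (fun _ => w k r))).
    + apply (pnorm_mx_cv pw 1 n1 (fun k _ => w k r)); [easy|]. intros i l _ Hl. now apply Hw.
    + replace (fun k => pnorm_mx pw 1 n1 (fun _ => w k r)) with (fun _ : nat => rw); [apply Un_cv_const|].
      extensionality k. rewrite <- pnorm_as_mx. symmetry. now apply H.
Qed.

Lemma Sp_nonempty : exists w u, Sp w u.
Proof.
  assert (Hpos : forall p N M, (1 <= N)%nat -> (1 <= M)%nat -> 0 < pnorm_mx p N M (fun _ _ => 1)).
  { intros. apply pnorm_mx_pos; auto. intros; lra. }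
  pose proof (Hpos pw 1%nat n1 (le_n 1) Hn1). pose proof (Hpos pu n1 d Hn1 Hd).
  exists (fun _ _ => rw * 1 / pnorm_mx pw 1 n1 (fun _ _ => 1)), (fun _ _ => ru * 1 / pnorm_mx pu n1 d (fun _ _ => 1)).
  split; [|split; [|split]].
  - intros. apply Rlt_le, Rdiv_lt_0_compat; lra.
  - intros. apply Rlt_le, Rdiv_lt_0_compat; lra.
  - now apply (pnorm_mx_normalized pu n1 d Hpu ru (fun _ _ => 1)).
  - intros r _. rewrite pnorm_as_mx. now apply (pnorm_mx_normalized pw 1 n1 Hpw rw (fun _ _ => 1)).
Qed.

Lemma Phi_max_exists : exists w u, Sp w u /\ forall w' u', Sp w' u' -> PhiF w' u' <= PhiF w u.
Proof.
  destruct (max_attained _ (fun z => Sp (fst z) (snd z)) (fun z => PhiF (fst z) (snd z)))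
    as [[w u] [HS Hmax]].
  - destruct Sp_nonempty as (w & u & H). now exists (w, u).
  - intros z Hz.
    set (cs := flat_map (fun r => map (fun l (z : (nat -> nat -> R) * (nat -> nat -> R)) => fst z r l)
                  (seq 0 n1)) (seq 0 K)
            ++ flat_map (fun l => map (fun m (z : (nat -> nat -> R) * (nat -> nat -> R)) => snd z l m)
                  (seq 0 d)) (seq 0 n1)).
    destruct (coordinates_cv_subseq _ z cs (Rmax rw ru)) as (phi & Hphi & Hcv).
    { intros c Hc k. destruct (Sp_entries_le d K n1 pw pu rw ru Hpw Hpu _ _ (Hz k)) as [Bw Bu].
      apply in_app_or in Hc as [Hc|Hc]; apply in_flat_map in Hc as (i & Hi & Hc);
        apply in_map_iff in Hc as (j & <- & Hj); apply in_seq in Hi, Hj.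
        destruct (Bw i j) as [B1 B2]; try lia. split; [easy|]. apply Rle_trans with (1 := B2), Rmax_l.
      - destruct (Bu i j) as [B1 B2]; try lia. split; [easy|]. apply Rle_trans with (1 := B2), Rmax_r. }
    (* Outside the index ranges the sequence need not converge, and the chosen value is then
       arbitrary. *)
    set (lim := fun v : nat -> R => epsilon (inhabits 0) (Un_cv v)).
    set (wl := fun r l => lim (fun k => fst (z (phi k)) r l)).
    set (ul := fun l m => lim (fun k => snd (z (phi k)) l m)).
    assert (Hw : mx_cv K n1 (fun k => fst (z (phi k))) wl).
    { intros r l Hr Hl. unfold wl, lim. apply epsilon_spec.
      apply (Hcv (fun z => fst z r l)). apply in_or_app. left. apply in_flat_map.
      exists r. split; [apply in_seq; lia|]. apply in_map_iff. exists l. split; [easy|]. apply in_seq; lia. }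
    assert (Hu : mx_cv n1 d (fun k => snd (z (phi k))) ul).
    { intros l m Hl Hm. unfold ul, lim. apply epsilon_spec.
      apply (Hcv (fun z => snd z l m)). apply in_or_app. right. apply in_flat_map.
      exists l. split; [apply in_seq; lia|]. apply in_map_iff. exists m. split; [easy|]. apply in_seq; lia. }
    assert (HSl : Sp wl ul) by (eapply Sp_closed; [|exact Hw|exact Hu]; intros; apply Hz).
    exists phi, (wl, ul). split; [easy|]. split; [exact HSl|]. simpl.
    apply (Phi_cv (fun k => fst (z (phi k))) (fun k => snd (z (phi k)))); auto.
    + intros k l m Hl Hm. now apply (Hz (phi k)).
    + intros l m Hl Hm. now apply HSl.
  - exists w, u. split; [exact HS|]. intros w' u' H. exact (Hmax (w', u') H).
Qed.

End Existence.

(** * Maximizers are positive fixed points *)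

(** The difference quotient has size [|h|^(p - 1)], which tends to 0 as [p > 1]: giving up p-th
    power mass is free to first order. *)
Lemma derivable_pt_lim_rpow_abs_0 (p : R) : 1 < p ->
  derivable_pt_lim (fun t => rpow (Rabs t) p) 0 0.
Proof.
  intros Hp e He.
  assert (Hd : 0 < rpow (e / 2) (/ (p - 1))) by (apply rpow_pos; lra).
  exists (mkposreal _ Hd). intros h Hh Hlt. simpl in Hlt.
  rewrite Rplus_0_l, Rabs_R0, rpow_0, !Rminus_0_r.
  pose proof (Rabs_pos_lt h Hh) as Hpos.
  unfold Rdiv. rewrite Rabs_mult, (Rabs_pos_eq (rpow _ _)), Rabs_inv by apply rpow_nonneg.
  replace p with (p - 1 + 1) at 1 by ring. rewrite rpow_plus, rpow_1 by lra.
  rewrite Rmult_assoc, Rinv_r, Rmult_1_r by lra.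
  apply Rle_lt_trans with (e / 2); [|lra].
  rewrite <- (rpow_inv_l (e / 2) (p - 1)) by lra. apply rpow_le; lra.
Qed.

(** * Optimality under exchange between two coordinates *)

Section TwoCoordinates.
Context (p : R) (F : R -> R -> R) (Hp : 1 < p).

(* Transferring [tau^p] of the p-th power budget to a coordinate equal to [0]
   costs [O(tau^p)] but gains at least [eps tau]. *)
Lemma zero_coordinate_not_max (eps b D : R) : 0 < eps -> 0 < b ->
  (forall t c, 0 <= t -> 0 <= c -> F 0 c + eps * t <= F t c) ->
  derivable_pt_lim (F 0) b D ->
  (forall t c, 0 <= t -> 0 <= c -> rpow t p + rpow c p = rpow b p -> F t c <= F 0 b) ->
  False.
Proof.
  intros Heps Hb Hinc HD Hmax.
  assert (Hbp : 0 < rpow b p) by now apply rpow_pos.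
  (* The value left to the second coordinate once the first has been raised to [t]; the absolute
     value makes [c] differentiable from both sides at 0. *)
  set (c := fun t => rpow (rpow b p - rpow (Rabs t) p) (/ p)).
  assert (Hc0 : c 0 = b).
  { unfold c. rewrite Rabs_R0, rpow_0, Rminus_0_r. apply rpow_inv_r; lra. }
  assert (Hc : derivable_pt_lim c 0 (/ p * rpow (rpow b p - rpow (Rabs 0) p) (/ p - 1) * (0 - 0))).
  { apply (derivable_pt_lim_rpow (fun t => rpow b p - rpow (Rabs t) p)).
    - rewrite Rabs_R0, rpow_0. lra.
    - apply (derivable_pt_lim_minus (fun _ => rpow b p) (fun t => rpow (Rabs t) p));
        [apply derivable_pt_lim_const | now apply derivable_pt_lim_rpow_abs_0]. }
  rewrite Rminus_0_r, Rmult_0_r in Hc.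
  assert (HG : derivable_pt_lim (fun t => F 0 (c t)) 0 (D * 0)).
  { apply (derivable_pt_lim_comp c (F 0)); [easy|]. now rewrite Hc0. }
  rewrite Rmult_0_r in HG.
  (* Zero derivative along [c] means a loss below [eps * h] for small [h], against the gain
     [eps * h] from [Hinc]. The choice [h <= b] keeps the base of [c] nonnegative, so the budget is
     met exactly. *)
  destruct (HG eps Heps) as [delta Hdelta]. pose proof (cond_pos delta) as Hdp.
  set (h := Rmin (delta / 2) b).
  assert (Hh : 0 < h) by (unfold h; apply Rmin_glb_lt; lra).
  assert (Hhd : h <= delta / 2) by apply Rmin_l.
  assert (Hhb : h <= b) by apply Rmin_r.
  specialize (Hdelta h). rewrite Rabs_pos_eq, Rplus_0_l, Rminus_0_r, Hc0 in Hdelta by lra.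
  apply Rabs_def2 in Hdelta as [_ Hlow]; try lra.
  assert (Hlow' : - eps * h < F 0 (c h) - F 0 b).
  { apply Rmult_lt_compat_r with (r := h) in Hlow; [|easy].
    replace ((F 0 (c h) - F 0 b) / h * h) with (F 0 (c h) - F 0 b) in Hlow by (field; lra). lra. }
  pose proof (Hinc h (c h) (Rlt_le _ _ Hh) (rpow_nonneg _ _)) as H1.
  enough (F h (c h) <= F 0 b) by lra.
  apply Hmax; [lra | apply rpow_nonneg|]. unfold c.
  rewrite rpow_inv_l, Rabs_pos_eq; try lra.
  assert (rpow h p <= rpow b p) by (apply rpow_le; lra). rewrite Rabs_pos_eq; lra.
Qed.

(** Taking the transferred p-th power as parameter stays on the sphere and makes 0 an interior
    maximum. The vanishing derivative, [Da * a^(1 - p) = Db * b^(1 - p)], is the multiplier rule for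
    one pair of coordinates. *)
Lemma two_coordinate_critical (a b Da Db : R) : 0 < a -> 0 < b ->
  (forall f g df dg, f 0 = a -> g 0 = b ->
     derivable_pt_lim f 0 df -> derivable_pt_lim g 0 dg ->
     derivable_pt_lim (fun t => F (f t) (g t)) 0 (df * Da + dg * Db)) ->
  (forall a' b', 0 <= a' -> 0 <= b' -> rpow a' p + rpow b' p = rpow a p + rpow b p ->
     F a' b' <= F a b) ->
  Da * rpow b (p - 1) = Db * rpow a (p - 1).
Proof.
  intros Ha Hb Hder Hmax.
  assert (Hap : 0 < rpow a p) by now apply rpow_pos.
  assert (Hbp : 0 < rpow b p) by now apply rpow_pos.
  set (f := fun t => rpow (rpow a p + t) (/ p)). set (g := fun t => rpow (rpow b p - t) (/ p)).
  assert (Hpow : forall z, 0 < z -> rpow (rpow z p) (/ p - 1) * rpow z (p - 1) = 1).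
  { intros z Hz. rewrite rpow_rpow by lra. rewrite <- rpow_plus.
    replace (p * (/ p - 1) + (p - 1)) with 0 by (field; lra).
    rewrite rpow_pos_eq by easy. now apply Rpower_O. }
  assert (Hf0 : f 0 = a) by (unfold f; rewrite Rplus_0_r; apply rpow_inv_r; lra).
  assert (Hg0 : g 0 = b) by (unfold g; rewrite Rminus_0_r; apply rpow_inv_r; lra).
  assert (Hf : derivable_pt_lim f 0 (/ p * rpow (rpow a p + 0) (/ p - 1) * (0 + 1))).
  { apply (derivable_pt_lim_rpow (fun t => rpow a p + t)); [lra|].
    apply (derivable_pt_lim_plus (fun _ => rpow a p) (fun t => t));
      [apply derivable_pt_lim_const | apply derivable_pt_lim_id]. }
  assert (Hg : derivable_pt_lim g 0 (/ p * rpow (rpow b p - 0) (/ p - 1) * (0 - 1))).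
  { apply (derivable_pt_lim_rpow (fun t => rpow b p - t)); [lra|].
    apply (derivable_pt_lim_minus (fun _ => rpow b p) (fun t => t));
      [apply derivable_pt_lim_const | apply derivable_pt_lim_id]. }
  rewrite Rplus_0_r in Hf. rewrite Rminus_0_r in Hg.
  pose proof (Hder f g _ _ Hf0 Hg0 Hf Hg) as Hd.
  (* For [|t| < m] both [a^p + t] and [b^p - t] are positive, so the power sum is preserved exactly
     on an open interval. *)
  set (m := Rmin (rpow a p) (rpow b p)).
  assert (Hm : 0 < m) by now apply Rmin_glb_lt.
  assert (Hma : m <= rpow a p) by apply Rmin_l. assert (Hmb : m <= rpow b p) by apply Rmin_r.
  pose (pr := exist _ _ Hd : derivable_pt (fun t => F (f t) (g t)) 0).
  assert (Hz : derive_pt _ 0 pr = 0).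
  { apply (deriv_maximum _ (- m) m); [lra | lra|]. intros t Ht1 Ht2. rewrite Hf0, Hg0.
    apply Hmax; try apply rpow_nonneg. unfold f, g. rewrite !rpow_inv_l; lra. }
  simpl in Hz.
  specialize (Hpow a Ha) as Pa. specialize (Hpow b Hb) as Pb.
  set (A := rpow (rpow a p) (/ p - 1)) in *. set (B := rpow (rpow b p) (/ p - 1)) in *.
  set (a' := rpow a (p - 1)) in *. set (b' := rpow b (p - 1)) in *.
  assert (Hz' : Da * A = Db * B).
  { apply Rmult_eq_reg_l with (/ p); [lra | apply Rinv_neq_0_compat; lra]. }
  transitivity (Da * A * (a' * b')).
  - transitivity (Da * (A * a') * b'); [rewrite Pa|]; ring.
  - rewrite Hz'. transitivity (Db * (B * b') * a'); [|rewrite Pb]; ring.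
Qed.

End TwoCoordinates.

Lemma pnorm_mx_pos_entry (p : R) (N M : nat) (v : nat -> nat -> R) :
  nonneg_mx N M v -> 0 < pnorm_mx p N M v -> exists i j, (i < N)%nat /\ (j < M)%nat /\ 0 < v i j.
Proof.
  intros Hv Hpos. unfold pnorm_mx in Hpos.
  assert (Hrp : forall z q, 0 < rpow z q -> 0 < z).
  { intros z q. unfold rpow. destruct (Rlt_dec 0 z); lra. }
  apply Hrp in Hpos.
  apply rsum_pos_ex in Hpos as (i & Hi & Hpos). apply rsum_pos_ex in Hpos as (j & Hj & Hpos).
  apply Hrp in Hpos. rewrite Rabs_pos_eq in Hpos by now apply Hv. now exists i, j.
Qed.

Lemma upd_ge (v : nat -> nat -> R) (i j k l : nat) (a b : R) :
  a <= b -> upd v i j a k l <= upd v i j b k l.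
Proof. intros H. unfold upd. destruct (andb _ _); lra. Qed.

(** * Exchanging p-th power mass between two matrix entries *)

Section Swap.
Context (p : R) (N M : nat) (Hp : 1 < p).

(** The function [phi] is left free to cover both p-th powers, for the norm, and the identity, for
    [entry_sum]. *)
Lemma rsum2_upd (v : nat -> nat -> R) (phi : R -> R) (i j : nat) (t : R) :
  (i < N)%nat -> (j < M)%nat ->
  rsum N (fun i' => rsum M (fun j' => phi (upd v i j t i' j')))
  = rsum N (fun i' => rsum M (fun j' => phi (v i' j'))) + (phi t - phi (v i j)).
Proof.
  intros Hi Hj.
  rewrite (rsum_update N (fun i' => rsum M (fun j' => phi (v i' j'))) _ i Hi).
  - rewrite (rsum_update M (fun j' => phi (v i j')) (fun j' => phi (upd v i j t i j')) j Hj).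
    + rewrite upd_same. ring.
    + intros j' _ Hne. rewrite upd_other; [easy | congruence].
  - intros i' _ Hne. apply rsum_ext. intros j' _. rewrite upd_other; [easy | congruence].
Qed.

Lemma pnorm_mx_swap (v : nat -> nat -> R) (i j i' j' : nat) (a b : R) :
  (i < N)%nat -> (j < M)%nat -> (i' < N)%nat -> (j' < M)%nat -> (i, j) <> (i', j') ->
  0 <= v i j -> 0 <= v i' j' -> 0 <= a -> 0 <= b ->
  rpow a p + rpow b p = rpow (v i j) p + rpow (v i' j') p ->
  pnorm_mx p N M (upd (upd v i' j' b) i j a) = pnorm_mx p N M v.
Proof.
  intros Hi Hj Hi' Hj' Hne H H' Ha Hb Hs. unfold pnorm_mx. f_equal.
  rewrite !(rsum2_upd _ (fun z => rpow (Rabs z) p)) by easy.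
  rewrite upd_other by easy. rewrite !Rabs_pos_eq by easy. lra.
Qed.

Lemma upd2_nonneg (v : nat -> nat -> R) (i j i' j' : nat) (a b : R) :
  nonneg_mx N M v -> 0 <= a -> 0 <= b -> nonneg_mx N M (upd (upd v i' j' b) i j a).
Proof.
  intros Hv Ha Hb k l Hk Hl. unfold upd.
  destruct (andb (Nat.eqb k i) (Nat.eqb l j)); [easy|].
  destruct (andb (Nat.eqb k i') (Nat.eqb l j')); [easy | now apply Hv].
Qed.

(** The ratio [k] of [g] to [v^(p - 1)] is the same at all entries; the power [/ (p - 1)] turns [g]
    into a constant multiple of [v], and the normalisation cancels the constant. *)
Lemma proportional_normalized (rho : R) (v g : nat -> nat -> R) :
  (1 <= N)%nat -> (1 <= M)%nat -> 0 < rho ->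
  (forall i j, (i < N)%nat -> (j < M)%nat -> 0 < v i j) ->
  (forall i j, (i < N)%nat -> (j < M)%nat -> 0 < g i j) ->
  (forall i j i' j', (i < N)%nat -> (j < M)%nat -> (i' < N)%nat -> (j' < M)%nat ->
     g i j * rpow (v i' j') (p - 1) = g i' j' * rpow (v i j) (p - 1)) ->
  pnorm_mx p N M v = rho ->
  forall i j, (i < N)%nat -> (j < M)%nat ->
    rho * rpow (g i j) (conj_exp p - 1)
      / pnorm_mx p N M (fun i j => rpow (g i j) (conj_exp p - 1)) = v i j.
Proof.
  intros HN HM Hr Hv Hg Hprop Hnorm.
  pose proof (Hv 0%nat 0%nat HN HM) as Hv0. pose proof (Hg 0%nat 0%nat HN HM) as Hg0.
  pose proof (rpow_pos _ (p - 1) Hv0) as Hvp.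
  set (k := g 0%nat 0%nat / rpow (v 0%nat 0%nat) (p - 1)).
  assert (Hk : 0 < k) by now apply Rdiv_lt_0_compat.
  pose proof (rpow_pos k (/ (p - 1)) Hk) as Hkp.
  assert (E : forall i j, (i < N)%nat -> (j < M)%nat ->
    rpow (g i j) (conj_exp p - 1) = rpow k (/ (p - 1)) * v i j).
  { intros i j Hi Hj. pose proof (Hv i j Hi Hj). rewrite conj_exp_minus_1 by easy.
    replace (g i j) with (k * rpow (v i j) (p - 1)).
    - rewrite rpow_mult, rpow_inv_r; try apply rpow_nonneg; lra.
    - apply Rmult_eq_reg_r with (rpow (v 0%nat 0%nat) (p - 1)); [|lra].
      rewrite (Hprop i j 0%nat 0%nat) by easy. unfold k. field. lra. }
  intros i j Hi Hj. rewrite (pnorm_mx_ext p N M _ _ E), pnorm_mx_scal, E, Hnorm by (lra || easy).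
  field. lra.
Qed.

End Swap.

(** * Optimality conditions at a maximizer *)

Section Optimality.
Context (n d K n1 : nat) (alpha : nat -> R) (x : nat -> nat -> R) (y : nat -> nat) (eps : R).
Context (Hn : (1 <= n)%nat) (Hd : (1 <= d)%nat) (Hn1 : (1 <= n1)%nat) (Heps : 0 < eps).
Context (Hx : forall i m, (i < n)%nat -> (m < d)%nat -> 0 <= x i m).
Context (Hy : forall i, (i < n)%nat -> (y i < K)%nat).
Context (Halpha : forall l, (l < n1)%nat -> 1 <= alpha l).
Context (pw pu rw ru : R) (Hpw : 1 < pw) (Hpu : 1 < pu) (Hrw : 0 < rw) (Hru : 0 < ru).

Notation PhiF := (Phi n d K n1 alpha x y eps).
Notation gwF := (gw n d K n1 alpha x y eps).
Notation guF := (gu n d K n1 alpha x y eps).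
Notation Sp := (in_Splus K n1 d pw pu rw ru).
Notation Spp := (in_Splusplus K n1 d pw pu rw ru).
Notation GF := (GPhi PhiF n1 d pw pu rw ru).

Lemma Phi_curve_w (w u : nat -> nat -> R) (r l l' : nat) (f g : R -> R) (t df dg : R) :
  (r < K)%nat -> (l < n1)%nat -> (l' < n1)%nat -> l <> l' ->
  f t = w r l -> g t = w r l' -> derivable_pt_lim f t df -> derivable_pt_lim g t dg ->
  derivable_pt_lim (fun s => PhiF (upd (upd w r l' (g s)) r l (f s)) u) t
    (df * gwF w u r l + dg * gwF w u r l').
Proof.
  intros Hr Hl Hl' Hne Ef Eg Hf Hg.
  rewrite <- !DPhi_unit_w, <- DPhi_lin by easy.
  assert (E : upd (upd w r l' (g t)) r l (f t) = w) by (rewrite Ef, Eg; apply upd2_id).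
  rewrite <- E at 1.
  apply (derivable_pt_lim_Phi n d K n1 alpha x y eps Hy (fun s => upd (upd w r l' (g s)) r l (f s)) (fun _ => u)).
  - intros i j _ _. apply derivable_pt_lim_upd2; auto. congruence.
  - intros i j _ _. unfold zero_mx. rewrite !Rmult_0_r, Rplus_0_r. apply derivable_pt_lim_const.
  - intros; now right.
Qed.

(** Unlike [w], which enters the net linearly, [u] enters through powers, so signs matter. The
    disjunction covers both uses: an entry frozen at 0 when zeros are excluded, a positive moving
    one for criticality. *)
Lemma Phi_curve_u (w u : nat -> nat -> R) (l m l' m' : nat) (f g : R -> R) (t df dg : R) :
  nonneg_mx n1 d u ->
  (l < n1)%nat -> (m < d)%nat -> (l' < n1)%nat -> (m' < d)%nat -> (l, m) <> (l', m') ->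
  f t = u l m -> g t = u l' m' -> derivable_pt_lim f t df -> derivable_pt_lim g t dg ->
  (0 < u l m \/ forall s, f s = u l m) -> 0 < u l' m' ->
  derivable_pt_lim (fun s => PhiF w (upd (upd u l' m' (g s)) l m (f s))) t
    (df * guF w u l m + dg * guF w u l' m').
Proof.
  intros Hu Hl Hm Hl' Hm' Hne Ef Eg Hf Hg Hfp Hgp.
  rewrite <- !DPhi_unit_u, <- DPhi_lin by easy.
  assert (E : upd (upd u l' m' (g t)) l m (f t) = u) by (rewrite Ef, Eg; apply upd2_id).
  rewrite <- E at 1.
  apply (derivable_pt_lim_Phi n d K n1 alpha x y eps Hy (fun _ => w) (fun s => upd (upd u l' m' (g s)) l m (f s))).
  - intros i j _ _. unfold zero_mx. rewrite !Rmult_0_r, Rplus_0_r. apply derivable_pt_lim_const.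
  - intros i j _ _. now apply derivable_pt_lim_upd2.
  - intros i l0 Hi Hl0.
    apply (pre_pos_or_const n d n1 x Hx (fun s => upd (upd u l' m' (g s)) l m (f s))); auto.
    + now rewrite E.
    + intros i' j' _ _. rewrite E. unfold upd.
      destruct (Nat.eqb_spec i' l), (Nat.eqb_spec j' m), (Nat.eqb_spec i' l'), (Nat.eqb_spec j' m');
        subst; simpl; auto.
Qed.

Context (w u : nat -> nat -> R) (HS : Sp w u).
Context (Hmax : forall w' u', Sp w' u' -> PhiF w' u' <= PhiF w u).

Lemma swap_w_le (r l l' : nat) (a b : R) :
  (r < K)%nat -> (l < n1)%nat -> (l' < n1)%nat -> l <> l' -> 0 <= a -> 0 <= b ->
  rpow a pw + rpow b pw = rpow (w r l) pw + rpow (w r l') pw ->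
  PhiF (upd (upd w r l' b) r l a) u <= PhiF w u.
Proof.
  intros Hr Hl Hl' Hne Ha Hb Hs. destruct HS as (H1 & H2 & H3 & H4). apply Hmax.
  split; [now apply upd2_nonneg|]. split; [easy|]. split; [easy|].
  intros r' Hr'. rewrite <- (H4 r' Hr'), !pnorm_as_mx. destruct (Nat.eq_dec r' r) as [->|Hrr].
  - rewrite <- (pnorm_mx_swap pw 1 n1 (fun _ => w r) 0 l 0 l' a b); auto; try congruence.
    apply pnorm_mx_ext. intros i j Hi Hj. unfold upd. replace i with 0%nat by lia.
    now rewrite !Nat.eqb_refl.
  - apply pnorm_mx_ext. intros i j Hi Hj. rewrite !upd_other by congruence. easy.
Qed.

Lemma swap_u_le (l m l' m' : nat) (a b : R) :
  (l < n1)%nat -> (m < d)%nat -> (l' < n1)%nat -> (m' < d)%nat -> (l, m) <> (l', m') ->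
  0 <= a -> 0 <= b -> rpow a pu + rpow b pu = rpow (u l m) pu + rpow (u l' m') pu ->
  PhiF w (upd (upd u l' m' b) l m a) <= PhiF w u.
Proof.
  intros Hl Hm Hl' Hm' Hne Ha Hb Hs. destruct HS as (H1 & H2 & H3 & H4). apply Hmax.
  split; [easy|]. split; [now apply upd2_nonneg|]. split; [|easy].
  rewrite <- H3. apply pnorm_mx_swap; auto.
Qed.

Lemma maximizer_w_pos (r l : nat) : (r < K)%nat -> (l < n1)%nat -> 0 < w r l.
Proof.
  intros Hr Hl. destruct HS as (H1 & H2 & H3 & H4).
  destruct (H1 r l Hr Hl) as [Hpos|H0]; [easy|]. exfalso.
  (* A positive norm provides an entry of the row from which mass can be taken. *)
  destruct (pnorm_mx_pos_entry pw 1 n1 (fun _ => w r)) as (_ & l' & _ & Hl' & Hpos).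
  { intros i j _ Hj. now apply H1. }
  { rewrite <- pnorm_as_mx, H4 by easy. easy. }
  assert (Hne : l <> l') by (intros ->; lra).
  apply (zero_coordinate_not_max pw (fun a b => PhiF (upd (upd w r l' b) r l a) u) Hpw eps (w r l')
    (0 * gwF w u r l + 1 * gwF w u r l')); auto.
  - intros t c Ht Hc.
    apply Rle_trans with (2 := Phi_mono n d K n1 alpha x y eps Hn Hx Hy Halpha
      (upd (upd w r l' c) r l 0) u (upd (upd w r l' c) r l t) u
      (upd2_nonneg K n1 w r l r l' 0 c H1 (Rle_refl 0) Hc) H2
      (fun i j _ _ => upd_ge _ r l i j 0 t Ht) (fun i j _ _ => Rle_refl _)).
    unfold entry_sum. rewrite !(rsum2_upd K n1 _ (fun z => z)) by easy. lra.
  - apply (Phi_curve_w w u r l l' (fun _ => 0) (fun b => b)); auto;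
      [apply derivable_pt_lim_const | apply derivable_pt_lim_id].
  - intros a b Ha Hb Hs.
    replace (PhiF (upd (upd w r l' (w r l')) r l 0) u) with (PhiF w u)
      by (rewrite H0, upd2_id; easy).
    apply swap_w_le; auto. rewrite <- H0, rpow_0. lra.
Qed.

Lemma maximizer_u_pos (l m : nat) : (l < n1)%nat -> (m < d)%nat -> 0 < u l m.
Proof.
  intros Hl Hm. destruct HS as (H1 & H2 & H3 & H4).
  destruct (H2 l m Hl Hm) as [Hpos|H0]; [easy|]. exfalso.
  destruct (pnorm_mx_pos_entry pu n1 d u) as (l' & m' & Hl' & Hm' & Hpos); [easy | now rewrite H3|].
  assert (Hne : (l, m) <> (l', m')) by (intros E; injection E as -> ->; lra).
  apply (zero_coordinate_not_max pu (fun a b => PhiF w (upd (upd u l' m' b) l m a)) Hpu eps (u l' m')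
    (0 * guF w u l m + 1 * guF w u l' m')); auto.
  - intros t c Ht Hc.
    apply Rle_trans with (2 := Phi_mono n d K n1 alpha x y eps Hn Hx Hy Halpha
      w (upd (upd u l' m' c) l m 0) w (upd (upd u l' m' c) l m t) H1
      (upd2_nonneg n1 d u l m l' m' 0 c H2 (Rle_refl 0) Hc)
      (fun i j _ _ => Rle_refl _) (fun i j _ _ => upd_ge _ l m i j 0 t Ht)).
    unfold entry_sum. rewrite !(rsum2_upd n1 d _ (fun z => z)) by easy. lra.
  - apply (Phi_curve_u w u l m l' m' (fun _ => 0) (fun b => b)); auto;
      [apply derivable_pt_lim_const | apply derivable_pt_lim_id].
  - intros a b Ha Hb Hs.
    replace (PhiF w (upd (upd u l' m' (u l' m')) l m 0)) with (PhiF w u)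
      by (rewrite H0, upd2_id; easy).
    apply swap_u_le; auto. rewrite <- H0, rpow_0. lra.
Qed.

Lemma maximizer_Spp : Spp w u.
Proof.
  split; [exact maximizer_w_pos|]. split; [exact maximizer_u_pos|]. split; apply HS.
Qed.

Lemma maximizer_critical_w (r l l' : nat) : (r < K)%nat -> (l < n1)%nat -> (l' < n1)%nat ->
  gwF w u r l * rpow (w r l') (pw - 1) = gwF w u r l' * rpow (w r l) (pw - 1).
Proof.
  intros Hr Hl Hl'. destruct (Nat.eq_dec l l') as [->|Hne]; [easy|].
  apply (two_coordinate_critical pw (fun a b => PhiF (upd (upd w r l' b) r l a) u) Hpw);
    try now apply maximizer_w_pos.
  - intros f g df dg Ef Eg Hf Hg. now apply Phi_curve_w.
  - intros a b Ha Hb Hs. rewrite upd2_id. now apply swap_w_le.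
Qed.

Lemma maximizer_critical_u (l m l' m' : nat) :
  (l < n1)%nat -> (m < d)%nat -> (l' < n1)%nat -> (m' < d)%nat ->
  guF w u l m * rpow (u l' m') (pu - 1) = guF w u l' m' * rpow (u l m) (pu - 1).
Proof.
  intros Hl Hm Hl' Hm'.
  destruct (classic ((l, m) = (l', m'))) as [E|Hne]; [injection E as -> ->; easy|].
  apply (two_coordinate_critical pu (fun a b => PhiF w (upd (upd u l' m' b) l m a)) Hpu);
    try now apply maximizer_u_pos.
  - intros f g df dg Ef Eg Hf Hg. apply Phi_curve_u; auto; try (left); try now apply maximizer_u_pos.
  - intros a b Ha Hb Hs. rewrite upd2_id. now apply swap_u_le.
Qed.

Lemma maximizer_fixed :
  (forall r l, (r < K)%nat -> (l < n1)%nat -> fst (GF (w, u)) r l = w r l) /\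
  (forall l m, (l < n1)%nat -> (m < d)%nat -> snd (GF (w, u)) l m = u l m).
Proof.
  destruct HS as (H1 & H2 & H3 & H4). pose proof maximizer_Spp as HSpp. split.
  - intros r l Hr Hl. rewrite G_w_eq by easy.
    apply (proportional_normalized pw 1 n1 Hpw rw (fun _ => w r) (fun _ => gwF w u r))
      with (i := 0%nat); auto.
    + intros; now apply maximizer_w_pos.
    + intros. apply Rlt_le_trans with (1 := Heps). now apply gw_ge_eps.
    + intros; now apply maximizer_critical_w.
    + rewrite <- pnorm_as_mx. now apply H4.
  - intros l m Hl Hm. rewrite G_u_eq by easy.
    apply (proportional_normalized pu n1 d Hpu ru u (guF w u)); auto.
    + exact maximizer_u_pos.
    + intros. apply Rlt_le_trans with (1 := Heps). now apply gu_ge_eps.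
    + intros; now apply maximizer_critical_u.
Qed.

End Optimality.

(** * Convergence of the iteration *)

Section Convergence.
Context (K n1 d : nat) (pw pu rw ru : R) (Hpw : 1 < pw) (Hpu : 1 < pu) (Hrw : 0 < rw) (Hru : 0 < ru).
Context (G : (nat -> nat -> R) * (nat -> nat -> R) -> (nat -> nat -> R) * (nat -> nat -> R)).
Context (g1 g2 rho : R) (Hg1 : 0 < g1) (Hg2 : 0 < g2) (Hrho : 0 < rho < 1).

Notation Spp := (in_Splusplus K n1 d pw pu rw ru).

Definition wdist (w u w' u' : nat -> nat -> R) : R :=
  g1 * rsum K (logdist_row n1 w w') + g2 * logdist_u d n1 u u'.

Context (HG : forall w u, Spp w u -> Spp (fst (G (w, u))) (snd (G (w, u)))).
Context (Hcontr : forall w u w' u', Spp w u -> Spp w' u' ->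
  wdist (fst (G (w, u))) (snd (G (w, u))) (fst (G (w', u'))) (snd (G (w', u')))
  <= rho * wdist w u w' u').

(** Equality is asked only inside the index ranges, since values outside carry no information;
    [wdist_ext] allows the replacement in distances. *)
Definition is_fixed (w u : nat -> nat -> R) : Prop :=
  (forall r l, (r < K)%nat -> (l < n1)%nat -> fst (G (w, u)) r l = w r l) /\
  (forall l m, (l < n1)%nat -> (m < d)%nat -> snd (G (w, u)) l m = u l m).

Lemma wdist_nonneg (w u w' u' : nat -> nat -> R) : 0 <= wdist w u w' u'.
Proof.
  apply Rplus_le_le_0_compat; apply Rmult_le_pos; try lra; [|apply logdist_u_nonneg].
  apply rsum_nonneg. intros; apply logdist_row_nonneg.
Qed.

Lemma wdist_ext (w1 u1 w1' u1' w2 u2 w2' u2' : nat -> nat -> R) :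
  (forall r l, (r < K)%nat -> (l < n1)%nat -> w1 r l = w2 r l /\ w1' r l = w2' r l) ->
  (forall l m, (l < n1)%nat -> (m < d)%nat -> u1 l m = u2 l m /\ u1' l m = u2' l m) ->
  wdist w1 u1 w1' u1' = wdist w2 u2 w2' u2'.
Proof.
  intros Hw Hu. unfold wdist. f_equal; f_equal.
  - apply rsum_ext. intros r Hr. apply rmax_ext. intros l Hl. now destruct (Hw r l Hr Hl) as [-> ->].
  - apply rmax_ext. intros l Hl. apply rmax_ext. intros m Hm. now destruct (Hu l m Hl Hm) as [-> ->].
Qed.

(** Entries are at most [rw] or [ru], so [lc_abs_diff] converts logarithmic into absolute distance
    with that factor; dividing by [g1] or [g2] undoes the weights. *)
Lemma dist_inf_le_wdist (w u w' u' : nat -> nat -> R) : Spp w u -> Spp w' u' ->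
  dist_inf K n1 d w u w' u' <= (rw / g1 + ru / g2) * wdist w u w' u'.
Proof.
  intros H H'. pose proof (wdist_nonneg w u w' u') as HV.
  destruct (Sp_entries_le d K n1 pw pu rw ru Hpw Hpu _ _ (Spp_Sp d K n1 pw pu rw ru _ _ H)) as [Bw Bu].
  destruct (Sp_entries_le d K n1 pw pu rw ru Hpw Hpu _ _ (Spp_Sp d K n1 pw pu rw ru _ _ H')) as [Bw' Bu'].
  assert (Cw : 0 < rw / g1) by now apply Rdiv_lt_0_compat.
  assert (Cu : 0 < ru / g2) by now apply Rdiv_lt_0_compat.
  assert (HS : 0 <= rsum K (logdist_row n1 w w'))
    by (apply rsum_nonneg; intros; apply logdist_row_nonneg).
  assert (HB : 0 <= logdist_u d n1 u u') by apply logdist_u_nonneg.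
  assert (HVw : rw * rsum K (logdist_row n1 w w') <= rw / g1 * wdist w u w' u').
  { replace (rw * rsum K (logdist_row n1 w w'))
      with (rw / g1 * (g1 * rsum K (logdist_row n1 w w'))) by (field; lra).
    apply Rmult_le_compat_l; [lra|]. unfold wdist.
    assert (0 <= g2 * logdist_u d n1 u u') by (apply Rmult_le_pos; lra). lra. }
  assert (HVu : ru * logdist_u d n1 u u' <= ru / g2 * wdist w u w' u').
  { replace (ru * logdist_u d n1 u u')
      with (ru / g2 * (g2 * logdist_u d n1 u u')) by (field; lra).
    apply Rmult_le_compat_l; [lra|]. unfold wdist.
    assert (0 <= g1 * rsum K (logdist_row n1 w w')) by (apply Rmult_le_pos; lra). lra. }
  assert (0 <= rw / g1 * wdist w u w' u') by (apply Rmult_le_pos; lra).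
  assert (0 <= ru / g2 * wdist w u w' u') by (apply Rmult_le_pos; lra).
  assert (0 <= (rw / g1 + ru / g2) * wdist w u w' u') by lra.
  apply Rmax_lub; apply rmax_le; auto; intros i Hi; apply rmax_le; auto; intros j Hj.
  - apply Rle_trans with (rw * logdist_row n1 w w' i).
    + apply lc_abs_diff; auto; [apply logdist_row_nonneg|].
      apply logdist_row_lc; auto; [now apply H | now apply H'].
    + assert (logdist_row n1 w w' i <= rsum K (logdist_row n1 w w')).
      { apply rsum_term_le; [intros; apply logdist_row_nonneg | easy]. }
      assert (rw * logdist_row n1 w w' i <= rw * rsum K (logdist_row n1 w w'))
        by (apply Rmult_le_compat_l; lra). lra.
  - apply Rle_trans with (ru * logdist_u d n1 u u'); [|lra].
    apply lc_abs_diff; auto. apply logdist_u_lc; auto; [now apply H | now apply H'].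
Qed.

Lemma dist_inf_entries (w u w' u' : nat -> nat -> R) : dist_inf K n1 d w u w' u' <= 0 ->
  (forall r l, (r < K)%nat -> (l < n1)%nat -> w r l = w' r l) /\
  (forall l m, (l < n1)%nat -> (m < d)%nat -> u l m = u' l m).
Proof.
  intros H.
  assert (Hz : forall a b, Rabs (a - b) <= 0 -> a = b).
  { intros a b Hab. pose proof (Rle_abs (a - b)). pose proof (Rle_abs (- (a - b))).
    rewrite Rabs_Ropp in *. lra. }
  split; intros i j Hi Hj; apply Hz; apply Rle_trans with (2 := H); unfold dist_inf.
  - eapply Rle_trans; [|apply Rmax_l].
    eapply Rle_trans; [|apply (rmax_ge K (fun r => rmax n1 (fun l => Rabs (w r l - w' r l)))); exact Hi].
    now apply (rmax_ge n1 (fun l => Rabs (w i l - w' i l))).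
  - eapply Rle_trans; [|apply Rmax_r].
    eapply Rle_trans; [|apply (rmax_ge n1 (fun l => rmax d (fun m => Rabs (u l m - u' l m)))); exact Hi].
    now apply (rmax_ge d (fun m => Rabs (u i m - u' i m))).
Qed.

Lemma fixed_point_unique (w u w' u' : nat -> nat -> R) :
  Spp w u -> Spp w' u' -> is_fixed w u -> is_fixed w' u' ->
  (forall r l, (r < K)%nat -> (l < n1)%nat -> w r l = w' r l) /\
  (forall l m, (l < n1)%nat -> (m < d)%nat -> u l m = u' l m).
Proof.
  intros H H' [Fw Fu] [Fw' Fu']. apply dist_inf_entries.
  pose proof (Hcontr w u w' u' H H') as Hc.
  rewrite (wdist_ext _ _ _ _ w u w' u') in Hc by auto.
  pose proof (wdist_nonneg w u w' u') as HV.
  assert (HV0 : wdist w u w' u' = 0) by nra.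
  pose proof (dist_inf_le_wdist w u w' u' H H') as Hle. rewrite HV0 in Hle. lra.
Qed.

Lemma iterates_converge (ws us w0 u0 : nat -> nat -> R) :
  Spp ws us -> is_fixed ws us -> Spp w0 u0 ->
  let sq := fun k : nat => Nat.iter k G (w0, u0) in
  Un_cv (fun k => dist_inf K n1 d (fst (sq k)) (snd (sq k)) ws us) 0 /\
  exists C, 0 < C /\ forall k, dist_inf K n1 d (fst (sq k)) (snd (sq k)) ws us <= C * rho ^ k.
Proof.
  intros Hs [Fw Fu] H0 sq.
  assert (Hk : forall k, Spp (fst (sq k)) (snd (sq k)) /\
            wdist (fst (sq k)) (snd (sq k)) ws us <= rho ^ k * wdist w0 u0 ws us).
  { induction k as [|k [HS HV]]; [simpl; split; [easy | lra]|].
    change (sq (S k)) with (G (sq k)). destruct (sq k) as [wk uk]. simpl fst in *. simpl snd in *.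
    split; [now apply HG|].
    rewrite <- (wdist_ext (fst (G (wk, uk))) (snd (G (wk, uk))) (fst (G (ws, us))) (snd (G (ws, us)))) by auto.
    apply Rle_trans with (1 := Hcontr wk uk ws us HS Hs). simpl. rewrite Rmult_assoc.
    apply Rmult_le_compat_l; lra. }
  (* The [+ 1] keeps [C] positive when the iteration starts at the fixed point. *)
  set (C := (rw / g1 + ru / g2) * wdist w0 u0 ws us + 1).
  assert (Hcst : 0 < rw / g1 + ru / g2) by (apply Rplus_lt_0_compat; now apply Rdiv_lt_0_compat).
  assert (HC : 0 < C).
  { pose proof (wdist_nonneg w0 u0 ws us).
    assert (0 <= (rw / g1 + ru / g2) * wdist w0 u0 ws us) by (apply Rmult_le_pos; lra).
    unfold C. lra. }
  assert (Hb : forall k, dist_inf K n1 d (fst (sq k)) (snd (sq k)) ws us <= C * rho ^ k).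
  { intros k. destruct (Hk k) as [HS HV]. apply Rle_trans with (1 := dist_inf_le_wdist _ _ _ _ HS Hs).
    apply Rle_trans with ((rw / g1 + ru / g2) * (rho ^ k * wdist w0 u0 ws us)).
    - apply Rmult_le_compat_l; lra.
    - assert (0 < rho ^ k) by (apply pow_lt; lra). unfold C. lra. }
  split; [|now exists C].
  intros e He. destruct (pow_lt_1_zero rho) with (y := e / C) as [N HN].
  { rewrite Rabs_pos_eq; lra. }
  { now apply Rdiv_lt_0_compat. }
  exists N. intros k HkN. specialize (HN k HkN). rewrite Rabs_pos_eq in HN by (apply pow_le; lra).
  unfold Rdist. rewrite Rminus_0_r, Rabs_pos_eq.
  - apply Rle_lt_trans with (1 := Hb k). apply Rmult_lt_compat_l with (r := C) in HN; [|easy].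
    replace (C * (e / C)) with e in HN by (field; lra). exact HN.
  - apply Rle_trans with (2 := Rmax_l _ _), rmax_nonneg.
Qed.

End Convergence.

Theorem theorem1
  (n d K n1 : nat) (x : nat -> nat -> R) (y : nat -> nat)
  (pw pu rw ru eps : R) (alpha : nat -> R) (rhoA : R)
  (Hn : (1 <= n)%nat) (Hd : (1 <= d)%nat) (Hn1 : (1 <= n1)%nat)
  (Hx : forall i m, (i < n)%nat -> (m < d)%nat -> 0 <= x i m)
  (Hy : forall i, (i < n)%nat -> (y i < K)%nat)
  (Hpw : 1 < pw) (Hpu : 1 < pu) (Hrw : 0 < rw) (Hru : 0 < ru) (Heps : 0 < eps)
  (Halpha : forall l, (l < n1)%nat -> 1 <= alpha l)
  (HrhoA : is_spectral_radius (S K) (Amat n d K n1 alpha x pw pu rw ru) rhoA)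
  (Hlt : rhoA < 1) :
  exists wst ust : nat -> nat -> R,
    in_Splus K n1 d pw pu rw ru wst ust /\
    (forall w u, in_Splus K n1 d pw pu rw ru w u ->
       Phi n d K n1 alpha x y eps w u <= Phi n d K n1 alpha x y eps wst ust) /\
    (forall w u, in_Splus K n1 d pw pu rw ru w u ->
       Phi n d K n1 alpha x y eps w u = Phi n d K n1 alpha x y eps wst ust ->
       (forall r l, (r < K)%nat -> (l < n1)%nat -> w r l = wst r l) /\
       (forall l m, (l < n1)%nat -> (m < d)%nat -> u l m = ust l m)) /\
    in_Splusplus K n1 d pw pu rw ru wst ust /\
    (forall w0 u0, in_Splusplus K n1 d pw pu rw ru w0 u0 ->
       let seq := fun k : nat =>
         Nat.iter k (GPhi (Phi n d K n1 alpha x y eps) n1 d pw pu rw ru) (w0, u0) in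
       Un_cv (fun k => dist_inf K n1 d (fst (seq k)) (snd (seq k)) wst ust) 0 /\
       exists Rc, 0 < Rc /\
         forall k, dist_inf K n1 d (fst (seq k)) (snd (seq k)) wst ust <= Rc * rhoA ^ k).

Proof.
  destruct (Phi_max_exists n d K n1 alpha x y eps Hn Hd Hn1 Hx Hy Halpha pw pu rw ru Hpw Hpu Hrw Hru)
    as (ws & us & HS & Hmax).
  (* Shown for an arbitrary maximizer: a second one is then also a positive fixed point, and the
     contraction identifies the two. *)
  assert (Hopt : forall w u : nat -> nat -> R, in_Splus K n1 d pw pu rw ru w u ->
    (forall w' u' : nat -> nat -> R, in_Splus K n1 d pw pu rw ru w' u' ->
       Phi n d K n1 alpha x y eps w' u' <= Phi n d K n1 alpha x y eps w u) ->
    in_Splusplus K n1 d pw pu rw ru w u /\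
    is_fixed K n1 d (GPhi (Phi n d K n1 alpha x y eps) n1 d pw pu rw ru) w u).
  { intros w u H HM. split.
    - now apply (maximizer_Spp n d K n1 alpha x y eps).
    - now apply maximizer_fixed. }
  destruct (Hopt ws us HS Hmax) as [HSpp Hfix].
  destruct (G_contraction n d K n1 alpha x y eps Hn Hd Hn1 Heps Hx Hy Halpha pw pu rw ru
    Hpw Hpu Hrw Hru rhoA HrhoA) as (g1 & g2 & Hg1 & Hg2 & Hr & Hcontr).
  exists ws, us. split; [exact HS|]. split; [exact Hmax|]. split; [|split; [exact HSpp|]].
  - intros w u H Heq.
    destruct (Hopt w u H) as [HSpp' Hfix']; [intros w' u' H'; rewrite Heq; now apply Hmax|].
    now apply (fixed_point_unique K n1 d pw pu rw ru Hpw Hpu Hrw Hru _ g1 g2 rhoA Hg1 Hg2 (conj Hr Hlt) Hcontr).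
  - intros w0 u0 H0.
    apply (iterates_converge K n1 d pw pu rw ru Hpw Hpu Hrw Hru _ g1 g2 rhoA Hg1 Hg2 (conj Hr Hlt)); auto.
    intros w u H. now apply G_preserves_Spp.
Qed.
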